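(* Let $X$ be a Banach space as described in the context, assume that the finite limit $\mu=\lim_{n\to\infty}\|z^n\|^{1/n}>0$ exists, and let $f\in X$, $\rho,\sigma\in(0,\infty)$. If $f$ is (the restriction to $\mathbb{D}$ of) an entire function of finite order $\rho$ and normal type $\sigma$, then $$\limsup_{n\to\infty}\frac{n}{e\rho}\left(\frac{E_n(f)}{\|z^n\|}\right)^{\rho/n}=\sigma .$$ Conversely, if this equality holds, then the sequence $(p_n^* )$ of polynomials of best approximation of $f$ in the norm of $X$ converges uniformly in each disk $|z|<r$, $r\in(0,\mu)$, to some entire function of finite order $\rho$ and normal type $\sigma$.
   Context: $\mathbb{D}=\{z\in\mathbb{C}:|z|<1\}$. Here $X$ is a complex Banach space of functions defined in $\mathbb{D}$ (not necessarily analytic) whose norm $\|\cdot\|$ satisfies: (i) $\|f(\cdot\, e^{it})\|=\|f(\cdot)\|$ for all $t\in\mathbb{R}$ and $f\in X$; (ii) $\|f\|<\infty$ for every entire function $f$; (iii) for all $f\in X$ and $g\in L[0,2\pi]$, $\big\|\frac{1}{2\pi}\int_0^{2\pi} f(ze^{it})g(t)\,dt\big\|\le \frac{1}{2\pi}\int_0^{2\pi}|g(t)|\,dt\cdot\|f\|$. For $n\ge 1$, $\mathcal{P}_n$ is the set of complex polynomials of degree at most $n-1$, $E_n(f)=\inf_{p\in\mathcal{P}_n}\|f-p\|$, $p_n^*\in\mathcal{P}_n$ is a polynomial with $\|f-p_n^*\|=E_n(f)$, and $\|z^n\|$ is the norm in $X$ of $z\mapsto z^n$. For an entire $F$ with $M(r)=\max_{|z|=r}|F(z)|$: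 order $\rho=\limsup_{r\to\infty}\frac{\ln\ln M(r)}{\ln r}$, type $\limsup_{r\to\infty}\frac{\ln M(r)}{r^\rho}$; normal type means the type lies in $(0,\infty)$. *)

(* Defs.v *)
From mathcomp Require Import all_boot all_order all_algebra.
From mathcomp Require Import all_classical all_reals all_analysis.
From mathcomp Require Export complex.
Import Order.TTheory GRing.Theory Num.Theory.
Import numFieldNormedType.Exports.

Set Implicit Arguments.
Unset Strict Implicit.
Unset Printing Implicit Defensive.

Local Open Scope classical_set_scope.
Local Open Scope ring_scope.

Section Defs.
Variable R : realType.
Local Notation C := (R[i]).

Definition cabs (z : C) : R := Normc.normc z.

Definition disk : set C := [set z | cabs z < 1].

Definition expi (t : R) : C := (cos t +i* sin t)%C.

Definition entire (F : C -> C) : Prop :=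
  forall z : C, derivable (F : C^o -> C^o) z 1.

Definition maxmod (F : C -> C) (r : R) : R :=
  sup [set cabs (F z) | z in [set z | cabs z = r]].

Definition order_of (F : C -> C) : \bar R :=
  limf_esup (fun r : R => (ln (ln (maxmod F r)) / ln r)%:E) +oo.

Definition type_of (F : C -> C) (rho : R) : \bar R :=
  limf_esup (fun r : R => (ln (maxmod F r) / r `^ rho)%:E) +oo.

Definition cintegrable (h : R -> C) : Prop :=
  (lebesgue_measure : measure _ R).-integrable `[0, 2 * pi]
     (EFin \o (fun t => complex.Re (h t))) /\
  (lebesgue_measure : measure _ R).-integrable `[0, 2 * pi]
     (EFin \o (fun t => complex.Im (h t))).

Definition cint (h : R -> C) : C :=
  ((Rintegral lebesgue_measure `[0, 2 * pi] (fun t => complex.Re (h t)))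
   +i* (Rintegral lebesgue_measure `[0, 2 * pi] (fun t => complex.Im (h t))))%C.

(* X (given by its carrier inX and its norm nX) is a complex Banach space of
   functions defined in D (functions C -> C, only their values in D matter),
   satisfying conditions (i), (ii), (iii). *)
Record funBanach (inX : set (C -> C)) (nX : (C -> C) -> R) : Prop := {
  X_ext : forall f g, inX f -> (forall z, disk z -> f z = g z) -> inX g;
  nX_ext : forall f g, inX f -> (forall z, disk z -> f z = g z) -> nX f = nX g;
  X_add : forall f g, inX f -> inX g -> inX (fun z => f z + g z);
  X_scale : forall (c : C) f, inX f -> inX (fun z => c * f z);
  nX_ge0 : forall f, inX f -> 0 <= nX f;
  nX_eq0 : forall f, inX f -> (nX f = 0 <-> forall z, disk z -> f z = 0);
  nX_scale : forall (c : C) f, inX f -> nX (fun z => c * f z) = cabs c * nX f;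
  nX_triangle : forall f g, inX f -> inX g ->
     nX (fun z => f z + g z) <= nX f + nX g;
  X_complete : forall u : nat -> (C -> C), (forall n, inX (u n)) ->
     (forall e : R, 0 < e -> exists N : nat, forall m n : nat,
         (N <= m)%N -> (N <= n)%N -> nX (fun z => u m z - u n z) < e) ->
     exists f, inX f /\ (fun n => nX (fun z => u n z - f z)) @ \oo --> (0 : R);
  X_rot : forall (t : R) f, inX f ->
     inX (fun z => f (z * expi t)) /\ nX (fun z => f (z * expi t)) = nX f;
  X_entire : forall F, entire F -> inX F;
  X_conv : forall f (g : R -> C), inX f -> cintegrable g ->
     (forall z, disk z -> cintegrable (fun t => f (z * expi t) * g t)) /\
     inX (fun z => (((2 * pi)^-1)%:C)%C * cint (fun t => f (z * expi t) * g t)) /\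
     nX (fun z => (((2 * pi)^-1)%:C)%C * cint (fun t => f (z * expi t) * g t))
       <= (2 * pi)^-1 * Rintegral lebesgue_measure `[0, 2 * pi] (fun t => cabs (g t))
          * nX f
}.

Definition nXmono (nX : (C -> C) -> R) (n : nat) : R := nX (fun z => z ^+ n).

Definition bestE (nX : (C -> C) -> R) (f : C -> C) (n : nat) : R :=
  inf [set nX (fun z => f z - p.[z]) | p in [set p : {poly C} | (size p <= n)%N]].

End Defs.

(* Main.v *)
Require Import Defs.
From mathcomp Require Import all_boot all_order all_algebra.
From mathcomp Require Import all_classical all_reals all_analysis.
From mathcomp Require Import complex.
From mathcomp Require Import ring lra zify.
Import Order.TTheory GRing.Theory Num.Theory.
Import numFieldNormedType.Exports.
Local Open Scope classical_set_scope.
Local Open Scope ring_scope.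
Set Implicit Arguments.
Unset Strict Implicit.

(* Condition (iii) with g(t) = e^(-int) gives |a_n| ||z^n|| <= E_n(F) for the n-th
   Taylor coefficient a_n of an entire F. In the other direction, the Taylor remainder
   is a convolution of F(2z) with a kernel of L^1-norm O(2^-n), so the Taylor series
   converges in norm and E_n(F) <= sum_(k>=n) |a_k| ||z^k||. Since ||z^n||^(1/n) tends
   to mu, the rate of E_n(F) / ||z^n|| is that of |a_n|, which encodes the type because
   (e rho A / n)^(n / rho) is the minimum over r of r^(-n) exp (A r^rho): Cauchy's
   estimate gives one inequality and summation of the series the other. A positive
   finite type for the exponent rho forces the order rho.
   For the converse, the k-th coefficients of the p_n^* form a Cauchy sequence, as
   ||p_m^* - p_n^*|| <= 2 E_n for m >= n; their limits define F, and F = f in the disk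
   because the norm distance vanishes.
   Taylor expansions come from Goursat's bisection argument, applied in the (s, t) plane
   to the homotopy z0 + e^s (r e^(it) - z0) that shrinks the circle to the point z0. *)

(** * Integrals of complex-valued functions *)

(** Limits superior are never computed with directly: a comparison with a constant [A] is replaced
    by an eventual bound by [gmaj A n], for each [A] separately. What makes this work is
    [gmaj A n / gmaj B n = (A / B)^(n / rho)]: passing from [A] to any larger [B] gains a geometric
    factor. It absorbs constants, the summation of tails, and the gap between [(mu - ep)^n] and
    [(mu + ep)^n], which is all that the limit [mu] says about [||z^n||]. In the converse, the
    [k]-th coefficient of [p_n^*] is within [4 E_n / ||z^k||] of its limit. Summing over [k < n]
    costs a factor [n], harmless because [E_n] decays faster than every geometric sequence; and for
    [r < mu] the weights [r^k / ||z^k||] stay bounded, which is where the disks of the theorem come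
    from. Entire functions are only assumed differentiable at each point, without continuity of the
    derivative; hence Goursat's argument instead of differentiation under the integral sign. *)

Section ComplexIntegral.
Variable R : realType.
Local Notation C := (R[i]).
Local Notation Re := complex.Re.
Local Notation Im := complex.Im.
Implicit Types (z w : C) (h g : R -> C) (a b t : R).

Lemma normcE z : `|z| = (cabs z)%:C%C. Proof. by []. Qed.

Lemma ReD z w : Re (z + w) = Re z + Re w. Proof. by case: z; case: w. Qed.
Lemma ImD z w : Im (z + w) = Im z + Im w. Proof. by case: z; case: w. Qed.
Lemma ReN z : Re (- z) = - Re z. Proof. by case: z. Qed.
Lemma ImN z : Im (- z) = - Im z. Proof. by case: z. Qed.
Lemma ReM z w : Re (z * w) = Re z * Re w - Im z * Im w.
Proof. by case: z; case: w. Qed.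
Lemma ImM z w : Im (z * w) = Re z * Im w + Im z * Re w.
Proof. by case: z; case: w. Qed.
Lemma complex_ext z w : Re z = Re w -> Im z = Im w -> z = w.
Proof. by case: z; case: w => ? ? ? ? /= -> ->. Qed.

Lemma cabs_ge0 z : 0 <= cabs z.
Proof. by rewrite -lecR -normcE normr_ge0. Qed.
Lemma cabsD z w : cabs (z + w) <= cabs z + cabs w.
Proof. by rewrite -lecR rmorphD /= -!normcE ler_normD. Qed.
Lemma cabsM z w : cabs (z * w) = cabs z * cabs w.
Proof. exact: Normc.normcM. Qed.
Lemma cabsV z : cabs z^-1 = (cabs z)^-1.
Proof. exact: Normc.normcV. Qed.
Lemma cabs0 : cabs (0 : C) = 0. Proof. exact: Normc.normc0. Qed.
Lemma cabs1 : cabs (1 : C) = 1. Proof. exact: Normc.normc1. Qed.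
Lemma cabs0_eq0 z : cabs z = 0 -> z = 0. Proof. exact: Normc.eq0_normc. Qed.
Lemma cabs_eq0 z : (cabs z == 0) = (z == 0).
Proof. by apply/eqP/eqP => [/cabs0_eq0//|->]; exact: cabs0. Qed.
Lemma cabs_gt0 z : (0 < cabs z) = (z != 0).
Proof. by rewrite lt_neqAle cabs_ge0 andbT eq_sym cabs_eq0. Qed.
Lemma cabsX z n : cabs (z ^+ n) = cabs z ^+ n.
Proof. by elim: n => [|n IH]; rewrite ?cabs1// !exprS cabsM IH. Qed.
Lemma cabsN z : cabs (- z) = cabs z.
Proof. by apply: complexI; rewrite -!normcE normrN. Qed.
Lemma cabsB z w : cabs (z - w) <= cabs z + cabs w.
Proof. by rewrite -(cabsN w) cabsD. Qed.
Lemma cabsBC z w : cabs (z - w) = cabs (w - z).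
Proof. by rewrite -cabsN opprB. Qed.
Lemma cabsR (x : R) : cabs x%:C%C = `|x|.
Proof. by rewrite /cabs /= expr0n /= addr0 sqrtr_sqr. Qed.
Lemma cabs_sum (I : Type) (r : seq I) (P : pred I) (f : I -> C) :
  cabs (\sum_(i <- r | P i) f i) <= \sum_(i <- r | P i) cabs (f i).
Proof.
elim/big_rec2 : _ => [|i x y _ H]; first by rewrite cabs0.
by apply: le_trans (cabsD _ _) _; rewrite lerD2l.
Qed.
Lemma cabs_trans (p z w : C) : cabs (z - w) <= cabs (z - p) + cabs (p - w).
Proof. by rewrite -[z - w](subrKA p) cabsD. Qed.

Lemma Re_le_cabs z : `|Re z| <= cabs z.
Proof.
case: z => a b; rewrite /cabs /= -sqrtr_sqr ler_sqrt ?lerDl ?sqr_ge0//.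
by rewrite addr_ge0 ?sqr_ge0.
Qed.
Lemma Im_le_cabs z : `|Im z| <= cabs z.
Proof.
case: z => a b; rewrite /cabs /= -sqrtr_sqr ler_sqrt ?lerDr ?sqr_ge0//.
by rewrite addr_ge0 ?sqr_ge0.
Qed.
Lemma cabs_le_ReIm z : cabs z <= `|Re z| + `|Im z|.
Proof.
have -> : z = (Re z)%:C%C + 'i%C * (Im z)%:C%C by rewrite -complexE.
apply: le_trans (cabsD _ _) _; rewrite cabsM !cabsR.
have -> : cabs ('i%C : C) = 1 by rewrite /cabs /= expr0n expr1n /= add0r sqrtr1.
rewrite mul1r; case: z => x y /=.
by rewrite !(mulr0,mul0r,subr0,addr0,mul1r,add0r).
Qed.

Lemma expi_cabs t : cabs (expi t) = 1.
Proof. by rewrite /cabs /= cos2Dsin2 sqrtr1. Qed.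
Lemma expi0 : expi (0 : R) = 1.
Proof. by rewrite /expi cos0 sin0. Qed.
Lemma expiD t s : expi (t + s) = expi t * expi s.
Proof.
apply: complex_ext; rewrite ?ReM ?ImM /= ?cosD ?sinD //; ring.
Qed.
Lemma expi_neq0 t : expi t != 0.
Proof. by rewrite -cabs_gt0 expi_cabs. Qed.
Lemma expiN t : expi (- t) = (expi t)^-1.
Proof.
by apply: (mulfI (expi_neq0 t)); rewrite -expiD subrr expi0 divff ?expi_neq0.
Qed.
Lemma expiX t n : expi t ^+ n = expi (n%:R * t).
Proof.
elim: n => [|n IH]; first by rewrite mul0r expi0.
by rewrite exprS IH -expiD -natr1 mulrDl mul1r addrC.
Qed.
Lemma expi_2pi_nat n : expi (n%:R * (2 * pi) : R) = 1.
Proof.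
rewrite -expiX (_ : expi (2 * pi) = 1) ?expr1n//.
by rewrite /expi mulr_natl cos2pi sin2pi.
Qed.
Lemma twopi_gt0 : 0 < 2 * pi :> R. Proof. by rewrite mulr_gt0// pi_gt0. Qed.

Definition ccont h := continuous (fun t => Re (h t)) /\ continuous (fun t => Im (h t)).

Lemma ccont_cst z : ccont (fun=> z).
Proof. by split=> t; exact: cst_continuous. Qed.
Lemma ccontD h g : ccont h -> ccont g -> ccont (fun t => h t + g t).
Proof.
move=> [h1 h2] [g1 g2]; split=> t.
- under [X in continuous_at _ X]funext do rewrite ReD.
  by apply: continuousD; [exact: h1|exact: g1].
- under [X in continuous_at _ X]funext do rewrite ImD.
  by apply: continuousD; [exact: h2|exact: g2].
Qed.
Lemma ccontM h g : ccont h -> ccont g -> ccont (fun t => h t * g t).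
Proof.
move=> [h1 h2] [g1 g2]; split=> t.
- under [X in continuous_at _ X]funext do rewrite ReM.
  by apply: cvgB; apply: cvgM; [exact: h1|exact: g1|exact: h2|exact: g2].
- under [X in continuous_at _ X]funext do rewrite ImM.
  by apply: cvgD; apply: cvgM; [exact: h1|exact: g2|exact: h2|exact: g1].
Qed.
Lemma ccontZ z h : ccont h -> ccont (fun t => z * h t).
Proof. exact/ccontM/ccont_cst. Qed.
Lemma ccontN h : ccont h -> ccont (fun t => - h t).
Proof.
by move=> /(ccontZ (-1)); congr ccont; apply/funext => t; rewrite mulN1r.
Qed.
Lemma ccontB h g : ccont h -> ccont g -> ccont (fun t => h t - g t).
Proof. by move=> hh hg; apply: ccontD => //; exact: ccontN. Qed.
Lemma ccont_sum (I : Type) (r : seq I) (f : I -> R -> C) :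
  (forall i, ccont (f i)) -> ccont (fun t => \sum_(i <- r) f i t).
Proof.
move=> H; elim: r => [|i r IH].
  by under [X in ccont X]funext do rewrite big_nil; exact: ccont_cst.
by under [X in ccont X]funext do rewrite big_cons; exact: ccontD.
Qed.
Lemma ccontX h n : ccont h -> ccont (fun t => h t ^+ n).
Proof.
move=> H; elim: n => [|n IH]; first exact: ccont_cst.
by under [X in ccont X]funext do rewrite exprS; exact: ccontM.
Qed.
Lemma ccont_real (f : R -> R) : continuous f -> ccont (fun t => (f t)%:C%C).
Proof. by move=> H; split => //= t; exact: cst_continuous. Qed.
Lemma ccont_expi : ccont (@expi R).
Proof. by split; [exact: continuous_cos|exact: continuous_sin]. Qed.
Lemma ccont_expiN : ccont (fun t => expi (- t)).
Proof.
split=> t /=; apply: (@continuous_comp _ _ _ (fun t : R => - t));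
  [exact: continuousN|exact: continuous_cos|exact: continuousN|exact: continuous_sin].
Qed.

Definition c_continuous (F : C -> C) := forall p e, 0 < e -> exists2 d : R, 0 < d &
  forall z, cabs (z - p) < d -> cabs (F z - F p) < e.

Lemma ccont_comp (F : C -> C) h : c_continuous F -> ccont h -> ccont (fun t => F (h t)).
Proof.
move=> HF [h1 h2].
have key t e : 0 < e -> \forall s \near t, cabs (F (h t) - F (h s)) < e.
  move=> e0; have [d d0 Hd] := HF (h t) e e0.
  have d2 : 0 < d / 2 by rewrite divr_gt0.
  have /cvgrPdist_lt /(_ _ d2) H1 := h1 t.
  have /cvgrPdist_lt /(_ _ d2) H2 := h2 t.
  near=> s; rewrite cabsBC; apply: Hd; rewrite cabsBC.
  apply: le_lt_trans (cabs_le_ReIm _) _; rewrite [d]splitr.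
  by rewrite ReD ImD ReN ImN; apply: ltrD; near: s.
by split=> t; apply/cvgrPdist_lt => e /(key t); apply: filterS => s;
  apply: le_lt_trans; rewrite -1?ReN -1?ReD -1?ImN -1?ImD ?Re_le_cabs ?Im_le_cabs.
Unshelve. all: by end_near.
Qed.

(** On [[0, 2 pi]], [cintg] and [ci] unfold to the same terms as [cintegrable] and [cint], so
    condition (iii) applies to them as they stand; the homotopy needs other intervals. *)
Definition cintg a b h :=
  (lebesgue_measure : measure _ R).-integrable `[a, b] (EFin \o (fun t => Re (h t))) /\
  (lebesgue_measure : measure _ R).-integrable `[a, b] (EFin \o (fun t => Im (h t))).

Definition ci a b h : C :=
  ((Rintegral lebesgue_measure `[a, b] (fun t => Re (h t)))
   +i* (Rintegral lebesgue_measure `[a, b] (fun t => Im (h t))))%C.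

Lemma continuous_integrable_itv (f : R -> R) a b : continuous f ->
  (lebesgue_measure : measure _ R).-integrable `[a, b] (EFin \o f).
Proof.
move=> cf; apply: continuous_compact_integrable; first exact: segment_compact.
exact: continuous_subspaceT.
Qed.

Lemma ccont_cintg a b h : ccont h -> cintg a b h.
Proof. by move=> [h1 h2]; split; apply: continuous_integrable_itv. Qed.

Lemma integrableD_fin (f g : R -> R) a b :
  (lebesgue_measure : measure _ R).-integrable `[a, b] (EFin \o f) ->
  (lebesgue_measure : measure _ R).-integrable `[a, b] (EFin \o g) ->
  (lebesgue_measure : measure _ R).-integrable `[a, b] (EFin \o (fun t => f t + g t)).
Proof.
move=> hf hg; rewrite (_ : EFin \o _ = (EFin \o f) \+ (EFin \o g))%E//.
exact: integrableD.
Qed.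

Lemma integrableZ_fin (f : R -> R) a b k :
  (lebesgue_measure : measure _ R).-integrable `[a, b] (EFin \o f) ->
  (lebesgue_measure : measure _ R).-integrable `[a, b] (EFin \o (fun t => k * f t)).
Proof.
move=> hf; rewrite (_ : _ \o _ = (fun t => k%:E * (EFin \o f) t)%E)//.
exact: integrableZl.
Qed.

Lemma cintgD a b h g : cintg a b h -> cintg a b g -> cintg a b (fun t => h t + g t).
Proof.
move=> [h1 h2] [g1 g2]; split.
- by under [X in EFin \o X]funext do rewrite ReD; apply: integrableD_fin.
- by under [X in EFin \o X]funext do rewrite ImD; apply: integrableD_fin.
Qed.

Lemma cintgZ a b z h : cintg a b h -> cintg a b (fun t => z * h t).
Proof.
move=> [h1 h2]; split.
- under [X in EFin \o X]funext do rewrite ReM -mulNr.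
  by apply: integrableD_fin; apply: integrableZ_fin.
- under [X in EFin \o X]funext do rewrite ImM.
  by apply: integrableD_fin; apply: integrableZ_fin.
Qed.

Lemma ciD a b h g : cintg a b h -> cintg a b g ->
  ci a b (fun t => h t + g t) = ci a b h + ci a b g.
Proof.
move=> [h1 h2] [g1 g2]; apply: complex_ext; rewrite ?ReD ?ImD /=.
- by under eq_Rintegral do rewrite ReD; rewrite RintegralD.
- by under eq_Rintegral do rewrite ImD; rewrite RintegralD.
Qed.

Lemma ciZ a b z h : cintg a b h -> ci a b (fun t => z * h t) = z * ci a b h.
Proof.
move=> [h1 h2]; apply: complex_ext; rewrite ?ReM ?ImM /=.
- under eq_Rintegral do rewrite ReM -mulNr.
  by rewrite RintegralD ?RintegralZl ?mulNr//; apply: integrableZ_fin.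
- under eq_Rintegral do rewrite ImM.
  by rewrite RintegralD ?RintegralZl//; apply: integrableZ_fin.
Qed.

Lemma ciB a b h g : cintg a b h -> cintg a b g ->
  ci a b (fun t => h t - g t) = ci a b h - ci a b g.
Proof.
move=> hh hg; under [X in ci _ _ X]funext do rewrite -[- g _]mulN1r.
by rewrite ciD ?ciZ ?mulN1r//; apply: cintgZ.
Qed.

Lemma cintg_sum a b n (f : nat -> R -> C) : (forall i, cintg a b (f i)) ->
  cintg a b (fun t => \sum_(i < n) f i t).
Proof.
move=> H; elim: n => [|n IH].
  by under [X in cintg _ _ X]funext do rewrite big_ord0; apply: ccont_cintg; exact: ccont_cst.
by under [X in cintg _ _ X]funext do rewrite big_ord_recr /=; exact: cintgD.
Qed.

Lemma ci_sum a b n (f : nat -> R -> C) : (forall i, cintg a b (f i)) ->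
  ci a b (fun t => \sum_(i < n) f i t) = \sum_(i < n) ci a b (f i).
Proof.
move=> H; elim: n => [|n IH].
  under [X in ci _ _ X]funext do rewrite big_ord0.
  rewrite big_ord0; have -> : (fun=> 0) = (fun t : R => 0 * (0 : C)) by apply/funext => t; rewrite mul0r.
  by rewrite ciZ ?mul0r//; apply: ccont_cintg; exact: ccont_cst.
under [X in ci _ _ X]funext do rewrite big_ord_recr /=.
by rewrite ciD ?IH ?big_ord_recr//; apply: cintg_sum.
Qed.

Lemma ci_cst a b z : a <= b -> ci a b (fun=> z) = z * (b - a)%:C%C.
Proof.
move=> ab; apply: complex_ext; rewrite ?ReM ?ImM /=;
  rewrite Rintegral_cst//= lebesgue_measure_itv /= lte_fin;
  move: ab; rewrite le_eqVlt => /predU1P[->|->] /=;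
  rewrite ?ltxx /= ?subrr; ring.
Qed.

Lemma ci_bound a b h M : a <= b -> cintg a b h ->
  (forall t, a <= t <= b -> cabs (h t) <= M) -> cabs (ci a b h) <= M * (b - a).
Proof.
move=> ab hh hM; set w := ci a b h.
have M0 : 0 <= M by apply: le_trans (cabs_ge0 (h a)) (hM a _); rewrite lexx ab.
have [w0|w0] := eqVneq w 0; first by rewrite w0 cabs0 mulr_ge0// subr_ge0.
(* rotating [w] onto the positive axis turns its modulus into a real integral *)
pose u := (cabs w)%:C%C / w.
have cu : cabs u = 1 by rewrite cabsM cabsV cabsR ger0_norm ?cabs_ge0// divff// cabs_eq0.
have -> : cabs w = Re (ci a b (fun t => u * h t)).
  by rewrite ciZ// -/w /u divfK.
have [h1 _] := cintgZ u hh.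
have -> : M * (b - a) = Re (ci a b (fun=> M%:C%C)).
  by rewrite ci_cst// ReM /= mul0r subr0.
apply: le_Rintegral => //; first by have [] := ccont_cintg a b (ccont_cst (M%:C%C)).
move=> t; rewrite /= in_itv /= => /hM /= ht; apply: le_trans (ler_norm _) _.
by apply: le_trans (Re_le_cabs _) _; rewrite cabsM cu mul1r.
Qed.

Lemma ci_split a b c h : ccont h -> a <= c -> c <= b ->
  ci a b h = ci a c h + ci c b h.
Proof.
move=> [h1 h2] ac cb.
have key (f : R -> R) : continuous f -> Rintegral lebesgue_measure `[a, b] f =
    Rintegral lebesgue_measure `[a, c] f + Rintegral lebesgue_measure `[c, b] f.
  move=> cf; have := @Rintegral_itvB R f (BLeft a) (BRight b) c (continuous_integrable_itv a b cf).
  rewrite !bnd_simp => /(_ ac cb) H.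
  rewrite -[X in _ + X]Rintegral_itv_obnd_cbnd; last first.
    apply: integrableS (continuous_integrable_itv c b cf) => //.
    by apply: subset_itv; rewrite bnd_simp.
  by rewrite -H addrC subrK.
by apply: complex_ext; rewrite ?ReD ?ImD /= key.
Qed.

Definition cder h g := forall t, is_derive t 1 (fun t => Re (h t)) (Re (g t)) /\
   is_derive t 1 (fun t => Im (h t)) (Im (g t)).

Lemma ci_FTC a b h g : a <= b -> cder g h -> ccont h -> ci a b h = g b - g a.
Proof.
rewrite le_eqVlt => /predU1P[<-|ab] dg [h1 h2].
  by rewrite subrr; apply: complex_ext; rewrite /= set_itv1 Rintegral_set1.
have key (f G : R -> R) : continuous f -> (forall t, is_derive t 1 G (f t)) ->
    Rintegral lebesgue_measure `[a, b] f = G b - G a.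
  move=> cf dG; have dG' t : derivable G t 1 by have [] := dG t.
  have cG : continuous G.
    by move=> t; apply/differentiable_continuous/derivable1_diffP.
  rewrite /Rintegral (@continuous_FTC2 _ _ G)//.
  - exact: continuous_subspaceT.
  - split=> //.
    + by apply: cvg_at_right_filter; exact: cG.
    + by apply: cvg_at_left_filter; exact: cG.
  - by move=> t _; rewrite derive1E; have [_ ->] := dG t.
apply: complex_ext; rewrite ?ReD ?ImD ?ReN ?ImN /=.
- by apply: (key _ (fun t => Re (g t))) => // t; have [] := dg t.
- by apply: (key _ (fun t => Im (g t))) => // t; have [] := dg t.
Qed.

Lemma cder_expi (k : R) : cder (fun t => expi (k * t)) (fun t => k%:C%C * ('i%C * expi (k * t))).
Proof.
move=> t; split; rewrite ?ReM ?ImM /=; apply: is_derive_eq.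
- by rewrite /GRing.scale /=; ring.
- by rewrite /GRing.scale /=; ring.
Qed.

End ComplexIntegral.

(** * Complex differentiability and bisection *)

Section Holomorphic.
Variable R : realType.
Local Notation C := (R[i]).
Local Notation Re := complex.Re.
Local Notation Im := complex.Im.

(** A first-order estimate instead of a limit of quotients: [h = 0] is no exception, and the radii
    are real, whereas those of the topology on [R[i]] are positive elements of [R[i]]. *)
Definition cdiff (F : C -> C) (p b : C) := forall e : R, 0 < e ->
  exists2 d : R, 0 < d & forall h, cabs h < d ->
    cabs (F (p + h) - F p - b * h) <= e * cabs h.

Lemma gt0_complexE (e : C) : 0 < e -> 0 < Re e /\ e = (Re e)%:C%C.
Proof. by case: e => a b; rewrite ltcE /= => /andP[/eqP -> ->]. Qed.

Lemma normc_lt (z e : C) : 0 < e -> (`|z| < e) = (cabs z < Re e).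
Proof. by case/gt0_complexE => _ {1}->; exact: ltcR. Qed.
Lemma normc_le (z e : C) : 0 < e -> (`|z| <= e) = (cabs z <= Re e).
Proof. by case/gt0_complexE => _ {1}->; exact: lecR. Qed.

Lemma entire_cdiff (F : C -> C) : entire F -> forall p, exists b, cdiff F p b.
Proof.
move=> HF p; have := HF p; rewrite /derivable => /cvg_ex[/= b].
move=> /cvgrPdist_le H; exists b => e e0.
have e0' : 0 < e%:C%C :> C by rewrite ltcR.
have := H _ e0' => /nbhs_ballP[d /= d0 Hd].
have [d1 dE] := gt0_complexE d0.
exists (Re d) => // h hd.
have [->|h0] := eqVneq h 0.
  by rewrite addr0 subrr mulr0 subrr cabs0 mulr0.
have hd' : `|0 - h| < d by rewrite sub0r normrN normc_lt.
have := Hd h hd' h0; rewrite /GRing.scale /= mulr1 => Hh.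
have {}Hh : cabs (b - h^-1 * (F (h + p) - F p)) <= e by rewrite -(normc_le _ e0').
have -> : F (p + h) - F p - b * h = h * (h^-1 * (F (h + p) - F p) - b).
  by rewrite mulrBr mulrA divff// mul1r (addrC h) (mulrC b).
by rewrite cabsM mulrC ler_wpM2r ?cabs_ge0// cabsBC.
Qed.

Lemma cdiff_entire (F : C -> C) : (forall p, exists b, cdiff F p b) -> entire F.
Proof.
move=> HF p; have [b Hb] := HF p; rewrite /derivable.
apply/cvg_ex; exists b; apply/cvgrPdist_le => e e0.
have [d d0 Hd] := Hb _ (gt0_complexE e0).1.
apply/nbhs_ballP; exists d%:C%C => /=; first by rewrite ltcR.
move=> h; rewrite -ball_normE => hd h0.
have {}hd : cabs h < d.
  have d0' : 0 < d%:C%C :> C by rewrite ltcR.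
  by move: hd; rewrite /ball_ /= sub0r normrN (normc_lt _ d0').
have {}h0 : h != 0 by [].
suff : cabs (b - h^-1 * (F (h + p) - F p)) <= Re e.
  by rewrite /GRing.scale /= mulr1 -(normc_le _ e0).
rewrite cabsBC; have := Hd h hd.
have -> : F (p + h) - F p - b * h = h * (h^-1 * (F (h + p) - F p) - b).
  by rewrite mulrBr mulrA divff// mul1r (addrC h) (mulrC b).
by rewrite cabsM mulrC ler_pM2r ?cabs_gt0.
Qed.

Lemma entire_continuous (F : C -> C) : entire F -> c_continuous F.
Proof.
move=> /entire_cdiff HF p e e0; have [b Hb] := HF p.
have [d d0 Hd] := Hb 1 ltr01.
have b1 : 0 < cabs b + 1 by rewrite ltr_wpDl ?cabs_ge0.
exists (Num.min d (e / (cabs b + 1))); first by rewrite lt_min d0 divr_gt0.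
move=> z; rewrite lt_min => /andP[zd ze].
have := Hd _ zd; rewrite (addrC p) subrK mul1r => H.
rewrite -[F z - F p](subrK (b * (z - p))); apply: le_lt_trans (cabsD _ _) _.
rewrite cabsM; move: ze; rewrite ltr_pdivlMr// => ze.
by apply: le_lt_trans ze; rewrite (mulrDr (cabs (z - p))) mulr1 [leRHS]addrC lerD// mulrC.
Qed.

(** Applied to the modulus of a difference, this turns an identity with a geometrically small error
    into an exact one. *)
Lemma geometric_le0 (x K q : R) n0 : 0 <= q < 1 ->
  (forall n, (n0 <= n)%N -> x <= K * q ^+ n) -> x <= 0.
Proof.
move=> /andP[q0 q1] H; rewrite leNgt; apply/negP => x0.
have : (fun n => K * q ^+ n) @ \oo --> K * 0.
  by apply: cvgM; [exact: cvg_cst|apply: cvg_expr; rewrite ger0_norm].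
rewrite mulr0 => /cvgrPdist_lt /(_ _ x0) [N _ HN].
have := HN (maxn N n0) (leq_maxl _ _); rewrite sub0r normrN => h.
have := H _ (leq_maxr N n0) => h'.
by have := lt_le_trans h (le_trans h' (ler_norm _)); rewrite ltxx.
Qed.

(** * Goursat's bisection for a subadditive function of rectangles *)

Section Bisection.
Variables (N : R -> R -> R -> R -> R) (a0 b0 c0 d0 : R).
Hypotheses (ab0 : a0 <= b0) (cd0 : c0 <= d0).
Hypothesis N_hsplit : forall a m b c d, a <= m -> m <= b -> c <= d ->
  N a b c d <= N a m c d + N m b c d.
Hypothesis N_vsplit : forall a b c m d, a <= b -> c <= m -> m <= d ->
  N a b c d <= N a b c m + N a b m d.
(** Differentiability at one point controls only small rectangles that contain this point. The
    square of the half-perimeter matters: it shrinks by 4 at each bisection, exactly as fast as the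
    share of [N] that is guaranteed to survive. *)
Hypothesis N_local : forall x y, a0 <= x <= b0 -> c0 <= y <= d0 ->
  forall e, 0 < e -> exists2 del : R, 0 < del & forall a b c d,
    a0 <= a <= x -> x <= b <= b0 -> c0 <= c <= y -> y <= d <= d0 ->
    b - a < del -> d - c < del -> N a b c d <= e * ((b - a) + (d - c)) ^+ 2.

Let hx n := (b0 - a0) / 2 ^+ n.
Let hy n := (d0 - c0) / 2 ^+ n.
Let N0 := N a0 b0 c0 d0.
(** [x] is the lower left corner of a rectangle of generation [n] that has kept its share of the
    initial value. *)
Let P n (x : R * R) := [/\ a0 <= x.1, x.1 + hx n <= b0, c0 <= x.2, x.2 + hy n <= d0 &
   N0 / 4 ^+ n <= N x.1 (x.1 + hx n) x.2 (x.2 + hy n)].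

Let hx_ge0 n : 0 <= hx n. Proof. by rewrite divr_ge0 ?exprn_ge0// subr_ge0. Qed.
Let hy_ge0 n : 0 <= hy n. Proof. by rewrite divr_ge0 ?exprn_ge0// subr_ge0. Qed.
Let half (L : R) n : L / 2 ^+ n = L / 2 ^+ n.+1 + L / 2 ^+ n.+1.
Proof. by rewrite exprS invfM; lra. Qed.

Let step n x : P n x -> exists y, [/\ P n.+1 y, x.1 <= y.1 <= x.1 + hx n.+1
  & x.2 <= y.2 <= x.2 + hy n.+1].
Proof.
case: x => a c [/= h1 h2 h3 h4 h5].
have Ex : hx n = hx n.+1 + hx n.+1 by exact: half.
have Ey : hy n = hy n.+1 + hy n.+1 by exact: half.
have px := hx_ge0 n.+1; have py := hy_ge0 n.+1.
set u := hx n.+1 in Ex px *; set v := hy n.+1 in Ey py *.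
have E4 : N0 / 4 ^+ n = 4 * (N0 / 4 ^+ n.+1) by rewrite exprS invfM; field.
have H1 : N a (a + hx n) c (c + hy n) <= N a (a + u) c (c + hy n) + N (a + u) (a + u + u) c (c + hy n).
  by rewrite Ex addrA; apply: N_hsplit; lra.
have H2 : N a (a + u) c (c + hy n) <= N a (a + u) c (c + v) + N a (a + u) (c + v) (c + v + v).
  by rewrite Ey addrA; apply: N_vsplit; lra.
have H3 : N (a + u) (a + u + u) c (c + hy n) <= N (a + u) (a + u + u) c (c + v) + N (a + u) (a + u + u) (c + v) (c + v + v).
  by rewrite Ey addrA; apply: N_vsplit; lra.
set E := N0 / 4 ^+ n.+1 in E4 *.
(* The values on the four quarters add up to at least [4 * E], so they cannot all be below [E]. *)
have [G|G1] := leP E (N a (a + u) c (c + v)).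
  by exists (a, c); split; [split|..] => /=; rewrite -?/u -?/v //; lra.
have [G|G2] := leP E (N a (a + u) (c + v) (c + v + v)).
  by exists (a, c + v); split; [split|..] => /=; rewrite -?/u -?/v //; lra.
have [G|G3] := leP E (N (a + u) (a + u + u) c (c + v)).
  by exists (a + u, c); split; [split|..] => /=; rewrite -?/u -?/v //; lra.
have G4 : E <= N (a + u) (a + u + u) (c + v) (c + v + v).
  have pigeonhole (t x1 x2 x3 x4 y1 y2 T : R) : T <= t -> t <= y1 + y2 -> y1 <= x1 + x2 ->
      y2 <= x3 + x4 -> T = 4 * E -> x1 < E -> x2 < E -> x3 < E -> E <= x4 by clear; lra.
  exact: pigeonhole h5 H1 H2 H3 E4 G1 G2 G3.
by exists (a + u, c + v); split; [split|..] => /=; rewrite -?/u -?/v -?/E //; clear -h1 h2 h3 h4 Ex Ey px py; lra.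
Qed.

(** A positive value would survive, divided by [4 ^+ n], in nested rectangles that shrink to a
    point, where [N_local] with a small enough [e] forbids it. *)
Lemma bisection_le0 : N a0 b0 c0 d0 <= 0.
Proof.
rewrite leNgt; apply/negP => N0_gt0.
have P0 : P 0 (a0, c0).
  by rewrite /P /hx /hy /= expr0 !divr1 !(addrC a0) !(addrC c0) !subrK; split.
pose nxt n (s : {x | P n x}) : {x | P n.+1 x} :=
  exist _ (projT1 (cid (step (projT2 s)))) (let: And3 h _ _ := projT2 (cid (step (projT2 s))) in h).
pose fix sq n : {x | P n x} := match n with 0%N => exist _ _ P0 | m.+1 => nxt m (sq m) end.
pose a n := (projT1 (sq n)).1; pose c n := (projT1 (sq n)).2.
have Pn n : P n (a n, c n) by rewrite /a /c -surjective_pairing; exact: (projT2 (sq n)).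
have stp n : a n <= a n.+1 <= a n + hx n.+1 /\ c n <= c n.+1 <= c n + hy n.+1.
  by rewrite /a /c /= /nxt /=; case: cid => y [? ? ?]; split.
(* Nested intervals [[u n, u n + h n]]: since the length halves and the left end moves by at most
   [h n.+1], the right ends decrease. *)
have lim (u : nat -> R) (h : nat -> R) : (forall n, 0 <= h n) -> (forall n, h n = h n.+1 + h n.+1) ->
    (forall n, u n <= u n.+1 <= u n + h n.+1) -> exists x, forall n, u n <= x <= u n + h n.
  move=> h0 hE H.
  have inc m n : (m <= n)%N -> u m <= u n.
    by apply: (@homo_leq _ u (fun x y => x <= y)) => // [x y z|k]; [exact: le_trans|have /andP[] := H k].
  have dec m n : (m <= n)%N -> u n + h n <= u m + h m.
    apply: (@homo_leq _ (fun n => u n + h n) (fun x y => y <= x)) => //.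
      by move=> x y z Hx Hy; exact: le_trans Hy Hx.
    by move=> k; have /andP[_] := H k; have := hE k; lra.
  have bd m n : u m <= u n + h n.
    have [mn|/ltnW nm] := leqP m n.
      by apply: le_trans (inc _ _ mn) _; rewrite lerDl.
    by apply: le_trans (dec _ _ nm); rewrite lerDl.
  exists (sup (range u)) => n; apply/andP; split.
    apply: ub_le_sup; last by exists n.
    by exists (u 0%N + h 0%N) => _ [m _ <-].
  by apply: ge_sup; [exists (u 0%N); exists 0%N|move=> _ [m _ <-]].
have [x Hx] := lim a hx hx_ge0 (half _) (fun n => proj1 (stp n)).
have [y Hy] := lim c hy hy_ge0 (half _) (fun n => proj2 (stp n)).
set L := (b0 - a0) + (d0 - c0).
have L0 : 0 <= L by rewrite addr_ge0// subr_ge0.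
(* Chosen so that [e * L ^+ 2 < N0]; the added 1 covers a degenerate rectangle, for which
   [L = 0]. *)
pose e := N0 / (2 * (L ^+ 2 + 1)).
have L1 : 0 < L ^+ 2 + 1 by rewrite ltr_wpDl ?sqr_ge0.
have e0 : 0 < e by rewrite divr_gt0// mulr_gt0.
have xI : a0 <= x <= b0.
  by have /andP[? ?] := Hx 0%N; have [/= ? ? _ _ _] := Pn 0%N; apply/andP; split; lra.
have yI : c0 <= y <= d0.
  by have /andP[? ?] := Hy 0%N; have [/= _ _ ? ? _] := Pn 0%N; apply/andP; split; lra.
have [del del0 Hdel] := N_local xI yI e0.
have [n Hn] : exists n, L / 2 ^+ n < del.
  apply/not_existsP => Hn.
  have : del <= 0; last by rewrite leNgt del0.
  apply: (@geometric_le0 _ L (1 / 2) 0%N); first by lra.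
  by move=> n _; rewrite expr_div_n expr1n div1r leNgt; apply/negP/Hn.
have hL : hx n + hy n = L / 2 ^+ n by rewrite -mulrDl.
have /= [p1 p2 p3 p4 p5] := Pn n.
have := hx_ge0 n; have := hy_ge0 n => hy0 hx0.
have := Hdel (a n) (a n + hx n) (c n) (c n + hy n).
rewrite !(addrC (a n)) !(addrC (c n)) !addrK hL.
have hd : hx n + hy n < del by rewrite hL.
have hxd : hx n < del by apply: le_lt_trans hd; rewrite lerDl.
have hyd : hy n < del by apply: le_lt_trans hd; rewrite lerDr.
have /andP[X1 X2] := Hx n; have /andP[Y1 Y2] := Hy n.
rewrite !(addrC (hx n)) !(addrC (hy n)) p1 p2 p3 p4 X1 X2 Y1 Y2.
move=> /(_ isT isT isT isT hxd hyd).
move=> Hle; have := le_trans p5 Hle.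
have -> : (4 : R) ^+ n = 2 ^+ n ^+ 2 by rewrite -exprM mulnC exprM; congr (_ ^+ _); ring.
rewrite expr_div_n mulrA ler_pM2r ?invr_gt0 ?exprn_gt0//.
apply/negP; rewrite -ltNge /e mulrAC ltr_pdivrMr ?mulr_gt0//.
by rewrite ltr_pM2l//; have := sqr_ge0 L; lra.
Qed.
End Bisection.

End Holomorphic.

(** * Cauchy's formula *)

Section Cauchy.
Variable R : realType.
Local Notation C := (R[i]).
Local Notation Re := complex.Re.
Local Notation Im := complex.Im.

Lemma ccont_expik (k : R) : ccont (fun t : R => expi (k * t)).
Proof.
split=> t /=; apply: (@continuous_comp _ _ _ (fun t : R => k * t));
  [exact: mulrl_continuous|exact: continuous_cos|exact: mulrl_continuous|exact: continuous_sin].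
Qed.

Lemma ccont_expR : ccont (fun s : R => (expR s)%:C%C).
Proof. by apply: ccont_real; exact: continuous_expR. Qed.

Lemma real_complexB (x y : R) : (x - y)%:C%C = x%:C%C - y%:C%C :> C.
Proof. exact: rmorphB. Qed.

Lemma eq_cabs_le (z w : C) : z = w -> cabs z <= cabs w.
Proof. by move->. Qed.

Lemma cabs_i : cabs ('i%C : C) = 1.
Proof. by rewrite /cabs /= expr0n expr1n /= add0r sqrtr1. Qed.

Lemma ci_expik (k a b : R) : a <= b ->
  ci a b (fun t => k%:C%C * ('i%C * expi (k * t))) = expi (k * b) - expi (k * a).
Proof.
move=> ab; apply: (ci_FTC (g := fun t => expi (k * t))) => //; first exact: cder_expi.
by do 2!apply: ccontZ; exact: ccont_expik.
Qed.

Lemma ci_expR (a b : R) : a <= b ->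
  ci a b (fun s => (expR s)%:C%C) = (expR b)%:C%C - (expR a)%:C%C.
Proof.
move=> ab; apply: (ci_FTC (g := fun s => (expR s)%:C%C)) => //; last exact: ccont_expR.
by move=> t; split => /=; [exact: is_derive_expR|exact: is_derive_cst].
Qed.

Lemma expi_lipschitz (t s : R) : cabs (expi t - expi s) <= `|t - s|.
Proof.
wlog st : s t / s <= t.
  by move=> H; have [/H//|/ltW/H] := leP s t; rewrite cabsBC distrC.
rewrite ger0_norm ?subr_ge0//.
have := ci_expik 1 st; rewrite !mul1r => <-.
rewrite -[leRHS]mul1r; apply: ci_bound => //.
  by apply: ccont_cintg; do 2!apply: ccontZ; exact: ccont_expik.
by move=> u _; rewrite !cabsM expi_cabs cabs_i cabsR normr1 !mulr1.
Qed.

(** On the half-line of nonpositive numbers, over which the parameter [s] of the homotopy runs, the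
    derivative of the exponential is at most 1. *)
Lemma expR_lipschitz (t s : R) : t <= 0 -> s <= 0 -> `|expR t - expR s| <= `|t - s|.
Proof.
wlog st : s t / s <= t.
  by move=> H t0 s0; have [/H->//|/ltW/H] := leP s t; rewrite distrC (distrC t); apply.
move=> t0 s0.
rewrite [leRHS]ger0_norm ?subr_ge0// -cabsR real_complexB -(ci_expR st).
rewrite -[leRHS]mul1r; apply: ci_bound => //; first by apply: ccont_cintg; exact: ccont_expR.
move=> u /andP[_ ut]; rewrite cabsR ger0_norm ?expR_ge0//.
by rewrite -expR0 ler_expR (le_trans ut).
Qed.

(** * Cauchy's formula by contracting a circle to an interior point *)

Section CircleHomotopy.
Variables (F : C -> C) (z0 : C) (r : R).
Hypotheses (HF : entire F) (z0r : cabs z0 < r).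

(** Since [cabs z0 < r], [q] never vanishes and its logarithmic derivative [k] is continuous. The
    homotopy approaches [z0] only as [s] tends to minus infinity, so no singularity has to be cut
    out of a rectangle. *)
Let q (t : R) : C := r%:C%C * expi t - z0.
Let qd (t : R) : C := r%:C%C * ('i%C * expi t).
Let k (t : R) : C := qd t / q t.
Let G (s t : R) : C := F (z0 + (expR s)%:C%C * q t).

Let r_gt0 : 0 < r. Proof. exact: le_lt_trans (cabs_ge0 _) z0r. Qed.

Let q_ge t : r - cabs z0 <= cabs (q t).
Proof.
have := cabsD (q t) z0; rewrite /q subrK cabsM expi_cabs cabsR gtr0_norm//.
by rewrite mulr1; lra.
Qed.
Let q_le t : cabs (q t) <= 2 * r.
Proof.
apply: le_trans (cabsB _ _) _; rewrite cabsM expi_cabs cabsR gtr0_norm//.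
by move: z0r; lra.
Qed.
Let q_neq0 t : q t != 0.
Proof. by rewrite -cabs_gt0; apply: lt_le_trans (q_ge t); rewrite subr_gt0. Qed.
Let K := r / (r - cabs z0).
Let K_ge0 : 0 <= K.
Proof. by rewrite divr_ge0 ?subr_ge0 ?ltW. Qed.
Let k_le t : cabs (k t) <= K.
Proof.
rewrite /k /qd !cabsM cabsV cabs_i expi_cabs cabsR gtr0_norm// !mulr1.
by rewrite ler_pM2l// lef_pV2 ?posrE ?subr_gt0 ?cabs_gt0.
Qed.

Let ccont_q : ccont q.
Proof. by apply: ccontB; [apply: ccontZ; exact: ccont_expi|exact: ccont_cst]. Qed.
Let ccont_qd : ccont qd.
Proof. by do 2!apply: ccontZ; exact: ccont_expi. Qed.

Let ccont_qV : ccont (fun t => (q t)^-1).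
Proof.
have [q1 q2] := ccont_q.
have nn t : Re (q t) ^+ 2 + Im (q t) ^+ 2 != 0.
  apply: contra (q_neq0 t); rewrite paddr_eq0 ?sqr_ge0// !expf_eq0 /=.
  by case: (q t) => x y /= /andP[/eqP-> /eqP->].
have ReV (z : C) : Re z^-1 = Re z / (Re z ^+ 2 + Im z ^+ 2) by case: z.
have ImV (z : C) : Im z^-1 = - (Im z / (Re z ^+ 2 + Im z ^+ 2)) by case: z.
have cn t : {for t, continuous (fun t => (Re (q t) ^+ 2 + Im (q t) ^+ 2)^-1)}.
  apply: cvgV => //; apply: cvgD; apply: cvgM; try exact: q1; exact: q2.
split=> t.
- under [X in continuous_at _ X]funext do rewrite ReV.
  by apply: cvgM; [exact: q1|exact: cn].
- under [X in continuous_at _ X]funext do rewrite ImV.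
  by apply: cvgN; apply: cvgM; [exact: q2|exact: cn].
Qed.

Let ccont_k : ccont k. Proof. exact: ccontM. Qed.
Let ccont_Gs t : ccont (fun s => G s t).
Proof.
apply: ccont_comp; first exact: entire_continuous.
by apply: ccontD; [exact: ccont_cst|apply: ccontM; [exact: ccont_expR|exact: ccont_cst]].
Qed.
Let ccont_Gt s : ccont (G s).
Proof.
apply: ccont_comp; first exact: entire_continuous.
by apply: ccontD; [exact: ccont_cst|exact: ccontZ].
Qed.

(* The integral of [F(z) dz / (z - z0)] along the boundary of the image of the
   rectangle [a, b] x [c, d] under [(s, t) |-> z0 + e^s q(t)]: the 1-form pulls
   back to [F (ds + k dt)] with [k = q' / q], in which [s] no longer occurs. *)
Let bd (H : R -> R -> C) a b c d : C :=
  ci c d (fun t => (H b t - H a t) * k t) - ci a b (fun s => H s d - H s c).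

(** The constant cancels in the differences, and because [k * q = qd] both integrals equal
    [B (e^b - e^a) (q d - q c)]. Affine functions of the point can therefore be subtracted from [F]
    at no cost. *)
Let bd_lin (A B : C) a b c d : a <= b -> c <= d ->
  bd (fun s t => A + B * ((expR s)%:C%C * q t)) a b c d = 0.
Proof.
move=> ab cd; rewrite /bd.
have -> : (fun t => (A + B * ((expR b)%:C%C * q t) - (A + B * ((expR a)%:C%C * q t))) * k t)
   = (fun t => (B * ((expR b)%:C%C - (expR a)%:C%C) * r%:C%C) * ((1 : R)%:C%C * ('i%C * expi (1 * t)))).
  apply/funext => t; rewrite mul1r /k /qd; move: (q_neq0 t) => qt.
  rewrite rmorph1 mul1r.
  have -> : forall u v w y : C, (A + B * (u * y) - (A + B * (v * y))) * (w / y) = B * (u - v) * w * (y / y).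
    by move=> u v w y; ring.
  by rewrite divff// mulr1; ring.
have -> : (fun s => A + B * ((expR s)%:C%C * q d) - (A + B * ((expR s)%:C%C * q c)))
   = (fun s => (B * (q d - q c)) * (expR s)%:C%C).
  by apply/funext => s; ring.
rewrite ciZ; last by apply: ccont_cintg; do 2!apply: ccontZ; exact: ccont_expik.
rewrite (ciZ _ (ccont_cintg a b ccont_expR)).
by rewrite ci_expR// ci_expik// /q !mul1r; ring.
Qed.

Let bd_G_lin (A B : C) a b c d : a <= b -> c <= d ->
  bd G a b c d = bd (fun s t => G s t - (A + B * ((expR s)%:C%C * q t))) a b c d.
Proof.
move=> ab cd; set L := fun s t : R => A + B * ((expR s)%:C%C * q t).
have cLt s : ccont (L s).
  by apply: ccontD; [exact: ccont_cst|do 2!apply: ccontZ].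
have cLs t : ccont (L^~ t).
  apply: ccontD; [exact: ccont_cst|apply: ccontZ; apply: ccontM; last exact: ccont_cst].
  exact: ccont_expR.
rewrite -[LHS]subr0 -(bd_lin A B ab cd) /bd -/L.
have -> : (fun t => (G b t - L b t - (G a t - L a t)) * k t) =
  (fun t => (G b t - G a t) * k t - (L b t - L a t) * k t) by apply/funext => t; ring.
have -> : (fun s => G s d - L s d - (G s c - L s c)) =
  (fun s => (G s d - G s c) - (L s d - L s c)) by apply/funext => t; ring.
have g1 := ccont_cintg c d (ccontM (ccontB (ccont_Gt b) (ccont_Gt a)) ccont_k).
have g2 := ccont_cintg c d (ccontM (ccontB (cLt b) (cLt a)) ccont_k).
have g3 := ccont_cintg a b (ccontB (ccont_Gs d) (ccont_Gs c)).
have g4 := ccont_cintg a b (ccontB (cLs d) (cLs c)).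
by rewrite (ciB g1 g2) (ciB g3 g4); ring.
Qed.

Let bd_bound H M a b c d : a <= b -> c <= d -> (forall t, ccont (H^~ t)) -> (forall s, ccont (H s)) ->
  (forall s t, a <= s <= b -> c <= t <= d -> cabs (H s t) <= M) ->
  cabs (bd H a b c d) <= 2 * M * K * (d - c) + 2 * M * (b - a).
Proof.
move=> ab cd Hs Ht HM; apply: le_trans (cabsB _ _) _; apply: lerD; apply: ci_bound => //.
- by apply: ccont_cintg; apply: ccontM => //; apply: ccontB.
- move=> t tcd; rewrite cabsM; apply: ler_pM; rewrite ?cabs_ge0 ?k_le//.
  apply: le_trans (cabsB _ _) _.
  by rewrite mulr_natl mulr2n lerD// HM// lexx ab.
- by apply: ccont_cintg; apply: ccontB.
- move=> s sab; apply: le_trans (cabsB _ _) _.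
  by rewrite mulr_natl mulr2n lerD// HM// lexx cd.
Qed.

(** After subtraction of the tangent of [F] at [p], the integrand is at most [e1] times the distance
    to [p], itself of order [D]; the sides of the rectangle contribute the second factor [D]. *)
Let bd_local x y : x <= 0 -> forall e, 0 < e -> exists2 del : R, 0 < del & forall a b c d,
    a <= x -> x <= b <= 0 -> c <= y -> y <= d ->
    b - a < del -> d - c < del -> cabs (bd G a b c d) <= e * ((b - a) + (d - c)) ^+ 2.
Proof.
move=> x0 e e0; set p := z0 + (expR x)%:C%C * q y.
have [B HB] := entire_cdiff HF p.
(* The final bound is [4 r (K + 1) e1 D^2]: a factor 2 from the differences in [bd], [2 r] from the
   distance to [p], and [K + 1] dominating the weights [K] and 1 of the two integrals. *)
pose e1 := e / (4 * r * (K + 1)).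
have K1 : 0 < K + 1 by rewrite ltr_wpDl.
have e10 : 0 < e1 by rewrite divr_gt0// !mulr_gt0.
have [del del0 Hd] := HB _ e10.
(* Both sides being shorter than this, [2 * r * D < del]. *)
exists (del / (4 * r)); first by rewrite divr_gt0// mulr_gt0.
move=> a b c d ax /andP[xb b0] cy yd abd cdd.
have ab : a <= b by exact: le_trans xb.
have cd : c <= d by exact: le_trans yd.
set D := (b - a) + (d - c).
have D0 : 0 <= D by rewrite addr_ge0// subr_ge0.
have near s t : a <= s <= b -> c <= t <= d ->
    cabs (z0 + (expR s)%:C%C * q t - p) <= 2 * r * D.
  move=> /andP[as_ sb] /andP[ct td].
  have -> : z0 + (expR s)%:C%C * q t - p =
     (expR s - expR x)%:C%C * q t + (expR x)%:C%C * (r%:C%C * (expi t - expi y)).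
    by rewrite /p /q rmorphB /=; ring.
  apply: le_trans (cabsD _ _) _; rewrite !cabsM !cabsR (gtr0_norm r_gt0).
  rewrite (ger0_norm (expR_ge0 _)).
  have h1 : `|expR s - expR x| <= b - a.
    apply: le_trans (expR_lipschitz _ x0) _; first exact: le_trans b0.
    by rewrite ler_norml; apply/andP; split; lra.
  have h2 : cabs (expi t - expi y) <= d - c.
    apply: le_trans (expi_lipschitz _ _) _.
    by rewrite ler_norml; apply/andP; split; lra.
  have h3 : expR x <= 1 by rewrite -expR0 ler_expR.
  have h4 : `|expR s - expR x| * cabs (q t) <= (b - a) * (2 * r).
    by apply: ler_pM; rewrite ?cabs_ge0.
  have h5 : expR x * (r * cabs (expi t - expi y)) <= 1 * (r * (d - c)).
    by apply: ler_pM; rewrite ?expR_ge0 ?mulr_ge0 ?cabs_ge0 ?ler_pM2l// ltW.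
  have h6 : 0 <= r * (d - c) by rewrite mulr_ge0 ?subr_ge0// ltW.
  by rewrite /D; lra.
(* The tangent [F p + B (z - p)] at [z = z0 + e^s q(t)], rewritten with [e^s q(t)] as variable. *)
rewrite (bd_G_lin (F p - B * (p - z0)) B ab cd).
apply: le_trans (bd_bound (M := e1 * (2 * r * D)) ab cd _ _ _) _.
- move=> t; apply: ccontB => //; apply: ccontD; first exact: ccont_cst.
  by apply: ccontZ; apply: ccontM; [exact: ccont_expR|exact: ccont_cst].
- by move=> s; apply: ccontB => //; apply: ccontD; [exact: ccont_cst|do 2!apply: ccontZ].
- move=> s t sab tcd; have := near _ _ sab tcd => ns.
  set w := z0 + (expR s)%:C%C * q t in ns *.
  have wd : cabs (w - p) < del.
    apply: le_lt_trans ns _; have r20 : 0 < 2 * r by rewrite mulr_gt0.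
    rewrite -ltr_pdivlMl//; have -> : (2 * r)^-1 * del = del / (4 * r) + del / (4 * r).
      by field; rewrite gt_eqF.
    by rewrite ltrD.
  have := Hd _ wd; rewrite (addrC p) subrK => Hw.
  have -> : G s t - (F p - B * (p - z0) + B * ((expR s)%:C%C * q t)) = F w - F p - B * (w - p).
    by rewrite /G /w; ring.
  by apply: le_trans Hw _; rewrite ler_pM2l.
have -> : e * D ^+ 2 = 2 * (e1 * (2 * r * D)) * (K + 1) * D.
  by rewrite /e1; field; rewrite !gt_eqF.
have M0 : 0 <= 2 * (e1 * (2 * r * D)).
  by apply: mulr_ge0 => //; apply: (mulr_ge0 (ltW e10)); rewrite !mulr_ge0// ltW.
set M := 2 * _ in M0 *.
have -> : M * K * (d - c) + M * (b - a) = M * (K * (d - c) + (b - a)) by ring.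
rewrite -(mulrA M) ler_wpM2l//.
have dc0 : 0 <= d - c by rewrite subr_ge0.
have ba0 : 0 <= b - a by rewrite subr_ge0.
have := mulr_ge0 K_ge0 ba0; rewrite /D; nra.
Qed.

Lemma ccont_cauchy_kernel : ccont k. Proof. exact: ccont_k. Qed.

(** The boundary integral over [[-L, 0] x [0, 2 pi]] vanishes by bisection. Its sides [t = 0] and
    [t = 2 pi] cancel by periodicity, which leaves the two closed curves. *)
Lemma cauchy_invariance (L : R) : 0 <= L ->
  ci 0 (2 * pi) (fun t => G 0 t * k t) = ci 0 (2 * pi) (fun t => G (- L) t * k t).
Proof.
move=> L0; have pi0 : 0 <= 2 * pi :> R by exact/ltW/twopi_gt0.
have : cabs (bd G (- L) 0 0 (2 * pi)) <= 0.
  apply: (@bisection_le0 _ (fun a b c d => cabs (bd G a b c d))) => //; first by lra.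
  - move=> a m b c d am mb cd; apply: le_trans (cabsD _ _); rewrite /bd.
    rewrite (ci_split (ccontB (ccont_Gs d) (ccont_Gs c)) am mb).
    have -> : (fun t => (G b t - G a t) * k t) =
      (fun t => (G m t - G a t) * k t + (G b t - G m t) * k t) by apply/funext => t; ring.
    have g1 := ccont_cintg c d (ccontM (ccontB (ccont_Gt m) (ccont_Gt a)) ccont_k).
    have g2 := ccont_cintg c d (ccontM (ccontB (ccont_Gt b) (ccont_Gt m)) ccont_k).
    rewrite (ciD g1 g2).
    by apply: eq_cabs_le; rewrite opprD addrACA.
  - move=> a b c m d ab cm md; apply: le_trans (cabsD _ _); rewrite /bd.
    rewrite (ci_split (ccontM (ccontB (ccont_Gt b) (ccont_Gt a)) ccont_k) cm md).
    have -> : (fun s => G s d - G s c) =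
      (fun s => (G s m - G s c) + (G s d - G s m)) by apply/funext => t; ring.
    have g3 := ccont_cintg a b (ccontB (ccont_Gs m) (ccont_Gs c)).
    have g4 := ccont_cintg a b (ccontB (ccont_Gs d) (ccont_Gs m)).
    rewrite (ciD g3 g4).
    by apply: eq_cabs_le; rewrite opprD addrACA.
  - move=> x y /andP[Lx x0] _ e e0; have [del del0 H] := bd_local y x0 e0.
    exists del => // a b c d /andP[_ ?] ? /andP[_ ?] /andP[? _] ? ?.
    exact: H.
move=> H; have /cabs0_eq0 : cabs (bd G (- L) 0 0 (2 * pi)) = 0.
  by apply/eqP; rewrite eq_le H cabs_ge0.
rewrite /bd => /eqP; rewrite subr_eq0 => /eqP.
have -> : (fun s => G s (2 * pi) - G s 0) = (fun=> 0).
  apply/funext => s; apply/eqP; rewrite subr_eq0 /G /q -[2 * pi]mul1r.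
  by rewrite (expi_2pi_nat _ 1) expi0.
have L0' : - L <= 0 by rewrite oppr_le0.
rewrite (ci_cst 0 L0') mul0r.
have -> : (fun t => (G 0 t - G (- L) t) * k t) = (fun t => G 0 t * k t - G (- L) t * k t).
  by apply/funext => t; ring.
rewrite (ciB (ccont_cintg _ _ (ccontM (ccont_Gt 0) ccont_k))
  (ccont_cintg _ _ (ccontM (ccont_Gt (- L)) ccont_k))).
by move/eqP; rewrite subr_eq0 => /eqP.
Qed.

(** The inner curve shrinks to [z0], where [F] is continuous. The integral of [k], that is [2 pi i]
    times a winding number, stays unevaluated here; the geometric series in [taylor_remainder] gives
    it. *)
Lemma cauchy_formula : ci 0 (2 * pi) (fun t => F (r%:C%C * expi t) * k t) =
  F z0 * ci 0 (2 * pi) k.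
Proof.
have pi0 : 0 <= 2 * pi :> R by exact/ltW/twopi_gt0.
have -> : (fun t => F (r%:C%C * expi t) * k t) = (fun t => G 0 t * k t).
  by apply/funext => t; rewrite /G expR0 mul1r /q (addrC z0) subrK.
set X := ci _ _ _; apply/eqP; rewrite -subr_eq0 -cabs_eq0 eq_le cabs_ge0 andbT.
apply/ler_addgt0Pr => e e0; rewrite add0r.
pose e1 := e / (K * (2 * pi) + 1).
have KP : 0 < K * (2 * pi) + 1 by rewrite ltr_wpDl// mulr_ge0.
have e10 : 0 < e1 by rewrite divr_gt0.
have [d d0 Hd] := entire_continuous HF z0 e10.
have [L L0 HL] : exists2 L : R, 0 <= L & expR (- L) * (2 * r) < d.
  (* With this [L], [e^L >= 1 + L > 2 r / d], and [2 r] bounds [cabs (q t)]. *)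
  exists (2 * r / d); first by rewrite divr_ge0 ?mulr_ge0 ?ltW.
  rewrite expRN mulrC ltr_pdivrMr ?expR_gt0//.
  rewrite (mulrC d) -ltr_pdivrMr//; apply: lt_le_trans (expR_ge1Dx _).
  by rewrite ltrDr.
rewrite /X (cauchy_invariance L0) -(ciZ _ (ccont_cintg _ _ ccont_k)).
rewrite -(ciB (ccont_cintg _ _ (ccontM (ccont_Gt (- L)) ccont_k)) (ccont_cintg _ _ (ccontZ (F z0) ccont_k))).
apply: le_trans (ci_bound (M := e1 * K) _ _ _) _ => //.
- apply: ccont_cintg; apply: ccontB; first exact: (ccontM (ccont_Gt (- L)) ccont_k).
  exact: ccontZ.
- move=> t _; rewrite -mulrBl cabsM ler_pM ?cabs_ge0//; apply/ltW/Hd.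
  rewrite addrAC subrr add0r cabsM cabsR ger0_norm ?expR_ge0//.
  by apply: le_lt_trans HL; rewrite ler_pM2l ?expR_gt0.
rewrite subr0 -mulrA /e1 mulrAC ler_pdivrMr// ler_pM2l//; lra.
Qed.

End CircleHomotopy.
End Cauchy.

(** * Taylor coefficients *)

Section Taylor.
Variable R : realType.
Local Notation C := (R[i]).
Local Notation Re := complex.Re.
Local Notation Im := complex.Im.
Local Notation pi2 := (2 * pi : R).

Let pi2_ge0 : 0 <= pi2. Proof. exact/ltW/twopi_gt0. Qed.
Let pi2_neq0 : pi2%:C%C != 0 :> C.
Proof. by rewrite -cabs_gt0 cabsR gtr0_norm twopi_gt0. Qed.

Lemma ccont_expiNk (k : R) : ccont (fun t : R => expi (- (k * t))).
Proof.
have -> : (fun t : R => expi (- (k * t))) = (fun t => expi ((- k) * t)).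
  by apply/funext => t; rewrite mulNr.
exact: ccont_expik.
Qed.

Lemma ci_orthogonal (j k : nat) :
  ci 0 pi2 (fun t => expi (j%:R * t) * expi (- (k%:R * t))) = if j == k then pi2%:C%C else 0.
Proof.
have [->|jk] := eqVneq j k.
  under [X in ci _ _ X]funext do rewrite -expiD subrr expi0.
  by rewrite ci_cst// subr0 mul1r.
under [X in ci _ _ X]funext do rewrite -expiD -mulrBl.
set K := j%:R - k%:R : R.
have K0 : K != 0 by rewrite subr_eq0 eqr_nat.
have := ci_expik K pi2_ge0.
rewrite mulr0 expi0 {2}/K mulrBl expiD expiN !expi_2pi_nat invr1 mulr1 subrr.
rewrite ciZ; last by apply: ccont_cintg; apply: ccontZ; exact: ccont_expik.
rewrite ciZ; last by apply: ccont_cintg; exact: ccont_expik.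
move=> /eqP; rewrite !mulf_eq0 => /or3P[|//|/eqP//].
- by rewrite -cabs_eq0 cabsR normr_eq0 (negbTE K0).
- by rewrite -cabs_eq0 cabs_i oner_eq0.
Qed.

Lemma geom_sum_le (q : R) n m : 0 <= q < 1 -> \sum_(n <= j < m) q ^+ j <= q ^+ n / (1 - q).
Proof.
move=> /andP[q0 q1]; have q10 : 0 < 1 - q by rewrite subr_gt0.
rewrite ler_pdivlMr//; have [nm|mn] := leqP n m; last first.
  by rewrite big_geq ?(ltnW mn)// mul0r exprn_ge0.
suff -> : (\sum_(n <= j < m) q ^+ j) * (1 - q) = q ^+ n - q ^+ m.
  by rewrite gerBl exprn_ge0.
have := telescope_sumr (fun j => - q ^+ j) nm; rewrite opprK addrC => <-.
by rewrite mulr_suml; apply: eq_bigr => j _; rewrite exprS; ring.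
Qed.

(** For [n > k] the partial sum has the right [k]-th Fourier coefficient by orthogonality, and the
    error is at most [2 pi K q^n] for all these [n], hence zero. *)
Lemma fourier_coef (h : R -> C) (c : nat -> C) (w : C) (K q : R) :
  0 <= q < 1 -> ccont h ->
  (forall n t, 0 <= t <= pi2 -> cabs (h t - \sum_(j < n) c j * (w * expi t) ^+ j) <= K * q ^+ n) ->
  forall k, ci 0 pi2 (fun t => h t * expi (- (k%:R * t))) = pi2%:C%C * (c k * w ^+ k).
Proof.
move=> q01 ch H k; apply/eqP; rewrite -subr_eq0 -cabs_eq0 eq_le cabs_ge0 andbT.
apply: (@geometric_le0 _ _ (K * pi2) q k.+1) => // n kn.
pose S t := \sum_(j < n) c j * (w * expi t) ^+ j.
have cS : ccont S.
  by apply: ccont_sum => j; apply: ccontZ; apply: ccontX; apply: ccontZ; exact: ccont_expi.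
have ce := ccont_expiNk k%:R.
have -> : pi2%:C%C * (c k * w ^+ k) = ci 0 pi2 (fun t => S t * expi (- (k%:R * t))).
  have -> : (fun t => S t * expi (- (k%:R * t))) =
    (fun t => \sum_(j < n) (fun (j : nat) t => (c j * w ^+ j) * (expi (j%:R * t) * expi (- (k%:R * t)))) j t).
    apply/funext => t; rewrite mulr_suml; apply: eq_bigr => j _.
    by rewrite exprMn expiX !mulrA.
  have ci2 (j : nat) : cintg 0 pi2 (fun t : R => expi (j%:R * t) * expi (- (k%:R * t))).
    by apply: ccont_cintg; apply: ccontM => //; exact: ccont_expik.
  rewrite (@ci_sum R 0 pi2 n (fun j t => (c j * w ^+ j) * (expi (j%:R * t) * expi (- (k%:R * t))))); last first.
    by move=> j; exact: cintgZ.
  under eq_bigr do rewrite (ciZ _ (ci2 _)) ci_orthogonal.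
  rewrite (bigD1 (Ordinal kn))//= eqxx big1 ?addr0 1?mulrC// => j jk.
  by rewrite (_ : _ == _ = false) ?mulr0//; apply: contraNF jk => /eqP jk; apply/eqP/val_inj.
rewrite -(ciB (ccont_cintg 0 pi2 (ccontM ch ce)) (ccont_cintg 0 pi2 (ccontM cS ce))).
have -> : K * pi2 * q ^+ n = K * q ^+ n * (pi2 - 0) by rewrite subr0 mulrAC.
apply: ci_bound => //.
  exact: (ccont_cintg 0 pi2 (ccontB (ccontM ch ce) (ccontM cS ce))).
by move=> t tI; rewrite -mulrBl cabsM expi_cabs mulr1 H.
Qed.

Lemma ccont_bounded h (a b : R) : ccont h -> exists M : R, forall t, a <= t <= b -> cabs (h t) <= M.
Proof.
move=> [h1 h2]; have [ab|ba] := leP a b; last first.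
  by exists 0 => t; lra.
have B (f : R -> R) : continuous f -> exists M, forall t, a <= t <= b -> `|f t| <= M.
  move=> cf; have : {within `[a, b], continuous (fun t => `|f t|)}.
    by apply: continuous_subspaceT => t; apply: cvg_norm; exact: cf.
  move=> /(EVT_max ab)[c _ Hc]; exists `|f c| => t tI; apply: Hc.
  by rewrite in_itv.
have [M1 H1] := B _ h1; have [M2 H2] := B _ h2.
exists (M1 + M2) => t tI; apply: le_trans (cabs_le_ReIm _) _.
by apply: lerD; [exact: H1|exact: H2].
Qed.

Definition taylor_coef (F : C -> C) (r : R) (n : nat) : C :=
  (pi2%:C%C * r%:C%C ^+ n)^-1 * ci 0 pi2 (fun t => F (r%:C%C * expi t) * expi (- (n%:R * t))).

Definition circle_bound (F : C -> C) (r M : R) :=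
  forall t : R, 0 <= t <= pi2 -> cabs (F (r%:C%C * expi t)) <= M.

Let cancel_coef (P Q X : C) : P != 0 -> Q != 0 -> (P * Q)^-1 * (P * (X * Q)) = X.
Proof. by move=> P0 Q0; field; rewrite P0 Q0. Qed.
Let cancel_coef' (P Q X Z : C) : P != 0 -> Q != 0 -> Z / Q * X = P * ((P * Q)^-1 * X * Z).
Proof. by move=> P0 Q0; field; rewrite P0 Q0. Qed.

Section TaylorEntire.
Variable F : C -> C.
Hypothesis HF : entire F.

Lemma ccont_circle (w : C) : ccont (fun t => F (w * expi t)).
Proof.
by apply: ccont_comp; [exact: entire_continuous|apply: ccontZ; exact: ccont_expi].
Qed.

Lemma circle_bounded r : exists M, circle_bound F r M.
Proof. exact: ccont_bounded (ccont_circle _). Qed.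

Lemma taylor_coef_bound r M n : 0 < r -> circle_bound F r M ->
  cabs (taylor_coef F r n) * r ^+ n <= M.
Proof.
move=> r0 HM; have pi0 := twopi_gt0 R.
have rn0 : 0 < r ^+ n by rewrite exprn_gt0.
rewrite /taylor_coef cabsM cabsV cabsM cabsX !cabsR !gtr0_norm//.
have : cabs (ci 0 pi2 (fun t => F (r%:C%C * expi t) * expi (- (n%:R * t)))) <= M * (pi2 - 0).
  apply: ci_bound => //.
    by apply: ccont_cintg; apply: ccontM; [exact: ccont_circle|exact: ccont_expiNk].
  by move=> t tI; rewrite cabsM expi_cabs mulr1 HM.
rewrite subr0 -ler_pdivrMr//; congr (_ <= _).
set X := cabs (ci _ _ _); move: X (2 * pi) (r ^+ n) pi0 rn0 => X y w y0 w0.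
by field; rewrite !gt_eqF.
Qed.

(** Up to the factor [i], the kernel of [cauchy_formula] is [1 / (1 - u)] with
    [u = (z / r) e^(-it)]. Expanding it to order [n] produces the Taylor polynomial, and the rest
    [u^n / (1 - u)] produces the bound. *)
Lemma taylor_remainder r M (z : C) n : cabs z < r -> circle_bound F r M ->
  cabs (F z - \sum_(j < n) taylor_coef F r j * z ^+ j) <=
  M / (1 - cabs z / r) * (cabs z / r) ^+ n.
Proof.
move=> zr HM; have r0 : 0 < r by exact: le_lt_trans (cabs_ge0 _) zr.
have rC : r%:C%C != 0 :> C by rewrite -cabs_gt0 cabsR gtr0_norm.
set q := cabs z / r; have q01 : 0 <= q < 1.
  by rewrite divr_ge0 ?cabs_ge0 ?ltW//= ltr_pdivrMr// mul1r.
have /andP[q0 q1] := q01.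
pose k t : C := r%:C%C * ('i%C * expi t) / (r%:C%C * expi t - z).
pose V t : C := - 'i%C * k t.
pose u t : C := (z / r%:C%C) * expi (- t).
have cV : ccont V by apply: ccontZ; exact: ccont_cauchy_kernel.
have cu : ccont u by apply: ccontZ; exact: ccont_expiN.
have ui t : cabs (u t) = q.
  by rewrite /u cabsM expi_cabs mulr1 cabsM cabsV cabsR gtr0_norm.
have u1 t : 1 - u t != 0.
  rewrite -cabs_gt0; have := cabsD (1 - u t) (u t); rewrite subrK cabs1 ui; lra.
have Vu t : V t = (1 - u t)^-1.
  have e0 := expi_neq0 t.
  have d0 : r%:C%C * expi t - z != 0.
    have -> : r%:C%C * expi t - z = r%:C%C * expi t * (1 - u t).
      by rewrite /u expiN; field; rewrite e0.
    by rewrite !mulf_neq0.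
  apply: (mulIf (u1 t)); rewrite mulVf// /V /k /u expiN.
  have ii : - 'i%C * 'i%C = 1 :> C by rewrite mulNr -expr2 sqr_i opprK.
  have -> : - 'i%C * (r%:C%C * ('i%C * expi t) / (r%:C%C * expi t - z)) *
    (1 - z / r%:C%C * (expi t)^-1) = (- 'i%C * 'i%C) * (r%:C%C * expi t * (1 - z / r%:C%C * (expi t)^-1) / (r%:C%C * expi t - z)).
    by ring.
  by rewrite ii mul1r; field; rewrite e0 rC d0.
have Vb t : cabs (V t) <= (1 - q)^-1.
  rewrite Vu cabsV lef_pV2 ?posrE ?subr_gt0 ?cabs_gt0//.
  have := cabsD (1 - u t) (u t); rewrite subrK cabs1 ui; lra.
have Vexp m t : V t = \sum_(j < m) u t ^+ j + u t ^+ m * V t.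
  have := subrX1 (u t) m => E; rewrite Vu; apply: (mulIf (u1 t)).
  by rewrite mulVf// mulrDl mulfVK// -[1 - u t]opprB mulrN mulrC -E; ring.
have ci_u j : ci 0 pi2 (fun t => u t ^+ j) = if j == 0%N then pi2%:C%C else 0.
  have -> : (fun t => u t ^+ j) = (fun t => (z / r%:C%C) ^+ j * (expi (0%:R * t) * expi (- (j%:R * t)))).
    by apply/funext => t; rewrite /u exprMn expiX mulrN mul0r expi0 mul1r.
  rewrite ciZ; last by apply: ccont_cintg; apply: ccontM; [exact: ccont_expik|exact: ccont_expiNk].
  by rewrite ci_orthogonal eq_sym; case: eqP => [->|_]; rewrite ?expr0 ?mul1r ?mulr0.
have split_V (h : R -> C) m : ccont h -> ci 0 pi2 (fun t => h t * V t) =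
    \sum_(j < m) ci 0 pi2 (fun t => h t * u t ^+ j) + ci 0 pi2 (fun t => h t * (u t ^+ m * V t)).
  move=> ch; have cj j : cintg 0 pi2 (fun t => h t * u t ^+ j).
    by apply: ccont_cintg; apply: ccontM => //; exact: ccontX.
  rewrite -(ci_sum _ cj) -ciD; last 2 first.
  - exact: (@cintg_sum R 0 pi2 m (fun j t => h t * u t ^+ j) cj).
  - by apply: ccont_cintg; apply: ccontM => //; apply: ccontM => //; exact: ccontX.
  congr ci; apply/funext => t.
  by rewrite {1}(Vexp m t) mulrDr mulr_sumr.
have err (h : R -> C) B m : ccont h -> (forall t, 0 <= t <= pi2 -> cabs (h t) <= B) ->
    cabs (ci 0 pi2 (fun t => h t * (u t ^+ m * V t))) <= pi2 * (B / (1 - q) * q ^+ m).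
  move=> ch hB.
  have -> : pi2 * (B / (1 - q) * q ^+ m) = B / (1 - q) * q ^+ m * (pi2 - 0) by rewrite subr0 mulrC.
  apply: ci_bound => //.
    by apply: ccont_cintg; apply: ccontM => //; apply: ccontM => //; exact: ccontX.
  move=> t tI; rewrite cabsM (cabsM (u t ^+ m)) cabsX ui.
  have -> : B / (1 - q) * q ^+ m = B * (q ^+ m * (1 - q)^-1) by ring.
  apply: ler_pM.
  - exact: cabs_ge0.
  - by rewrite mulr_ge0 ?exprn_ge0 ?cabs_ge0.
  - exact: hB.
  - by rewrite ler_wpM2l ?exprn_ge0.
(* The same expansion with [F = 1]: only [u ^+ 0] has a nonzero mean. *)
have ciV : ci 0 pi2 V = pi2%:C%C.
  apply/eqP; rewrite -subr_eq0 -cabs_eq0 eq_le cabs_ge0 andbT.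
  apply: (@geometric_le0 _ _ (pi2 * (1 / (1 - q))) q 1) => // -[//|m] _.
  have c1 := ccont_cst (1 : C).
  have -> : V = (fun t => 1 * V t) by apply/funext => t; rewrite mul1r.
  rewrite (split_V _ m.+1 c1) big_ord_recl big1 => [|j _]; last first.
    by under [X in ci _ _ X]funext do rewrite mul1r; rewrite ci_u.
  under [X in ci _ _ X + _]funext do rewrite mul1r.
  rewrite ci_u eqxx addr0 addrAC subrr add0r -mulrA; apply: err => // t _.
  by rewrite cabs1.
have main : pi2%:C%C * F z = ci 0 pi2 (fun t => F (r%:C%C * expi t) * V t).
  rewrite -ciV mulrC; have := cauchy_formula HF zr => cf.
  have ck : ccont k by exact: ccont_cauchy_kernel.
  rewrite /V ciZ; last exact: ccont_cintg.
  under [X in _ = ci _ _ X]funext do rewrite mulrCA.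
  rewrite ciZ; last by apply: ccont_cintg; apply: ccontM => //; exact: ccont_circle.
  by rewrite cf mulrCA.
have cj j : ci 0 pi2 (fun t => F (r%:C%C * expi t) * u t ^+ j) =
    pi2%:C%C * (taylor_coef F r j * z ^+ j).
  have -> : (fun t => F (r%:C%C * expi t) * u t ^+ j) =
     (fun t => (z / r%:C%C) ^+ j * (F (r%:C%C * expi t) * expi (- (j%:R * t)))).
    by apply/funext => t; rewrite /u exprMn expiX mulrN mulrCA.
  rewrite ciZ; last by apply: ccont_cintg; apply: ccontM; [exact: ccont_circle|exact: ccont_expiNk].
  have rj : r%:C%C ^+ j != 0 :> C by rewrite expf_neq0.
  by rewrite /taylor_coef expr_div_n; exact: cancel_coef'.
have fin := split_V _ n (ccont_circle r%:C%C).
rewrite -main (eq_bigr _ (fun (j : 'I_n) _ => cj j)) -mulr_sumr in fin.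
rewrite -(ler_pM2l (twopi_gt0 R)).
have -> : pi2 = cabs (pi2%:C%C : C) by rewrite cabsR gtr0_norm ?twopi_gt0.
rewrite -cabsM mulrBr fin addrAC subrr add0r cabsR gtr0_norm ?twopi_gt0//.
exact: err (ccont_circle _) HM.
Qed.

(** The expansion obtained from the larger circle converges geometrically on the smaller one, so its
    coefficients can be read off there. *)
Lemma taylor_coef_indep r s n : 0 < r -> r < s -> taylor_coef F r n = taylor_coef F s n.
Proof.
move=> r0 rs; have [M HM] := circle_bounded s.
have s0 : 0 < s by exact: lt_trans rs.
have rC : r%:C%C ^+ n != 0 :> C by rewrite -cabs_gt0 cabsX exprn_gt0// cabsR gtr0_norm.
rewrite {1}/taylor_coef.
rewrite (@fourier_coef _ (taylor_coef F s) r%:C%C (M / (1 - r / s)) (r / s)).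
- exact: cancel_coef.
- by rewrite divr_ge0 ?ltW//= ltr_pdivrMr// mul1r.
- exact: ccont_circle.
- move=> m t _; have zr : cabs (r%:C%C * expi t) = r.
    by rewrite cabsM expi_cabs cabsR gtr0_norm// mulr1.
  have := @taylor_remainder s M (r%:C%C * expi t) m; rewrite zr; exact.
Qed.

Lemma entire_taylor : exists c : nat -> C,
  (forall r M n, 0 < r -> circle_bound F r M -> cabs (c n) * r ^+ n <= M) /\
  (forall r M z n, cabs z < r -> circle_bound F r M ->
    cabs (F z - \sum_(j < n) c j * z ^+ j) <= M / (1 - cabs z / r) * (cabs z / r) ^+ n).
Proof.
exists (taylor_coef F 1).
have E r n : 0 < r -> taylor_coef F 1 n = taylor_coef F r n.
  move=> r0; have [r1|r1|->//] := ltgtP 1 r; first exact: taylor_coef_indep.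
  by rewrite (taylor_coef_indep _ r0 r1).
split=> [r M n r0 HM|r M z n zr HM].
  by rewrite (E r)//; exact: taylor_coef_bound.
have r0 : 0 < r by exact: le_lt_trans (cabs_ge0 _) zr.
by under eq_bigr do rewrite (E r _ r0); exact: taylor_remainder.
Qed.

End TaylorEntire.
End Taylor.

(** * Power series *)

Section PowerSeries.
Variable R : realType.
Local Notation C := (R[i]).
Local Notation Re := complex.Re.
Local Notation Im := complex.Im.

(** For nonnegative [u], an infinite radius of convergence, in the form of the bounds that tail
    estimates consume. *)
Definition rapid (u : nat -> R) := forall r : R, 0 < r ->
  exists K, forall n, u n * r ^+ n <= K.

Definition psum (a : nat -> C) (n : nat) (z : C) : C := \sum_(j < n) a j * z ^+ j.

(** Pointwise convergence is enough: with rapid coefficients it is locally uniform, at the rate of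
    [series_tail]. *)
Definition series_of (F : C -> C) (a : nat -> C) :=
  rapid (fun n => cabs (a n)) /\
  forall z e, 0 < e -> exists N : nat, forall n, (N <= n)%N -> cabs (F z - psum a n z) < e.

Lemma psumB (a : nat -> C) n m z : (n <= m)%N ->
  psum a m z - psum a n z = \sum_(n <= j < m) a j * z ^+ j.
Proof.
move=> nm; rewrite /psum -!(big_mkord predT (fun j => a j * z ^+ j)).
by rewrite (big_cat_nat _ nm)//= addrAC subrr add0r.
Qed.

Lemma ratio01 (x r : R) : 0 <= x -> x < r -> 0 <= x / r < 1.
Proof.
move=> x0 xr; have r0 : 0 < r by exact: le_lt_trans xr.
by rewrite ltr_pdivrMr// mul1r xr andbT divr_ge0// ltW.
Qed.

Lemma sum_tail_le (u : nat -> R) (x r K : R) n m : 0 <= x -> x < r -> 0 <= K ->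
  (forall j, u j * r ^+ j <= K) ->
  \sum_(n <= j < m) u j * x ^+ j <= K / (1 - x / r) * (x / r) ^+ n.
Proof.
move=> x0 xr K0 H; have r0 : 0 < r by exact: le_lt_trans xr.
have q01 := ratio01 x0 xr.
have un j : u j * x ^+ j <= K * (x / r) ^+ j.
  have -> : x ^+ j = r ^+ j * (x / r) ^+ j by rewrite -exprMn mulrC divfK// gt_eqF.
  by rewrite mulrA ler_wpM2r ?exprn_ge0//; case/andP: q01.
apply: (@le_trans _ _ (\sum_(n <= j < m) K * (x / r) ^+ j)); first exact: ler_sum.
have -> : K / (1 - x / r) * (x / r) ^+ n = K * ((x / r) ^+ n / (1 - x / r)) by ring.
by rewrite -mulr_sumr ler_wpM2l// geom_sum_le.
Qed.

Lemma rapid_bound (u : nat -> R) r : rapid u -> 0 < r -> exists2 K, 0 <= K &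
  forall n, u n * r ^+ n <= K.
Proof.
by move=> H /H[K HK]; exists `|K| => // n; exact: le_trans (HK n) (ler_norm _).
Qed.

Lemma psum_tail_le (a : nat -> C) (r K : R) z n m : cabs z < r -> (n <= m)%N ->
  0 <= K -> (forall j, cabs (a j) * r ^+ j <= K) ->
  cabs (psum a m z - psum a n z) <= K / (1 - cabs z / r) * (cabs z / r) ^+ n.
Proof.
move=> zr nm K0 HK; rewrite psumB//; apply: le_trans (cabs_sum _ _ _) _.
under eq_bigr do rewrite cabsM cabsX.
by apply: sum_tail_le => //; exact: cabs_ge0.
Qed.

Lemma series_tail (F : C -> C) a r K z n : series_of F a -> cabs z < r ->
  0 <= K -> (forall j, cabs (a j) * r ^+ j <= K) ->
  cabs (F z - psum a n z) <= K / (1 - cabs z / r) * (cabs z / r) ^+ n.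
Proof.
move=> [_ HF] zr K0 HK; apply/ler_addgt0Pr => e e0.
have [N HN] := HF z e e0.
apply: le_trans (cabs_trans (psum a (maxn N n) z) _ _) _.
rewrite addrC; apply: lerD; last by apply/ltW/HN; exact: leq_maxl.
by apply: psum_tail_le => //; exact: leq_maxr.
Qed.

(** The supremum of the lower ends [x n - e n] lies below every upper end [x n + e n], so the limit
    comes with the rate [e n] itself. *)
Lemma cauchy_real (x e : nat -> R) : (forall n m, (n <= m)%N -> `|x m - x n| <= e n) ->
  exists l, forall n, `|l - x n| <= e n.
Proof.
move=> H; have bd n m : x n - e n <= x m + e m.
  have h1 := H n _ (leq_maxl n m); have h2 := H m _ (leq_maxr n m).
  by move: h1 h2; rewrite !ler_norml; lra.
exists (sup [set x n - e n | n in setT]) => n.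
have h1 : x n - e n <= sup [set x n - e n | n in setT].
  by apply: ub_le_sup; [exists (x 0%N + e 0%N) => _ [m _ <-]|exists n].
have h2 : sup [set x n - e n | n in setT] <= x n + e n.
  by apply: ge_sup; [exists (x 0%N - e 0%N); exists 0%N|move=> _ [m _ <-]].
by rewrite ler_norml; lra.
Qed.

Lemma cauchy_complex (x : nat -> C) (e : nat -> R) :
  (forall n m, (n <= m)%N -> cabs (x m - x n) <= e n) ->
  exists l, forall n, cabs (l - x n) <= 2 * e n.
Proof.
move=> H.
have [l1 H1] : exists l, forall n, `|l - Re (x n)| <= e n.
  apply: cauchy_real => n m nm; rewrite -ReN -ReD.
  exact: le_trans (Re_le_cabs _) (H _ _ nm).
have [l2 H2] : exists l, forall n, `|l - Im (x n)| <= e n.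
  apply: cauchy_real => n m nm; rewrite -ImN -ImD.
  exact: le_trans (Im_le_cabs _) (H _ _ nm).
exists (l1 +i* l2)%C => n; apply: le_trans (cabs_le_ReIm _) _.
by rewrite ReD ImD ReN ImN /= mulr_natl mulr2n lerD.
Qed.

Lemma geometric_lt (K q e : R) : 0 <= q < 1 -> 0 < e ->
  exists N : nat, forall n, (N <= n)%N -> K * q ^+ n < e.
Proof.
move=> /andP[q0 q1] e0.
have : (fun n => K * q ^+ n) @ \oo --> K * 0.
  by apply: cvgM; [exact: cvg_cst|apply: cvg_expr; rewrite ger0_norm].
rewrite mulr0 => /cvgrPdist_lt /(_ _ e0) [N _ HN].
exists N => n /HN; rewrite sub0r normrN; apply: le_lt_trans; exact: ler_norm.
Qed.

Lemma series_exists (a : nat -> C) : rapid (fun n => cabs (a n)) -> exists F, series_of F a.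
Proof.
move=> ra.
have H z : exists l, forall e, 0 < e -> exists N : nat, forall n, (N <= n)%N -> cabs (l - psum a n z) < e.
  have r0 : 0 < cabs z + 1 by rewrite ltr_wpDl ?cabs_ge0.
  have zr : cabs z < cabs z + 1 by rewrite ltrDl.
  have [K K0 HK] := rapid_bound ra r0.
  set q := cabs z / (cabs z + 1); have q01 : 0 <= q < 1.
    exact: ratio01 (cabs_ge0 _) _.
  have [l Hl] := cauchy_complex (fun n m nm => psum_tail_le zr nm K0 HK).
  exists l => e e0; have [N HN] := geometric_lt (2 * (K / (1 - q))) q01 e0.
  by exists N => n /HN; apply: le_lt_trans; rewrite -mulrA; exact: Hl.
exists (fun z => projT1 (cid (H z))); split => // z; exact: (projT2 (cid (H z))).
Qed.

Lemma rapid_shift (a : nat -> C) : rapid (fun n => cabs (a n)) ->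
  rapid (fun n => cabs (n.+1%:R * a n.+1)).
Proof.
move=> ra r r0; have [K K0 HK] := rapid_bound ra (mulr_gt0 (ltr0Sn R 1) r0).
exists (K / r) => n; rewrite cabsM ler_pdivlMr//.
have -> : cabs (n.+1%:R : C) = n.+1%:R by rewrite -(rmorph_nat (real_complex R)) cabsR ger0_norm.
apply: le_trans (HK n.+1); rewrite -!mulrA -exprSr mulrC -mulrA ler_wpM2l ?cabs_ge0//.
rewrite exprMn mulrC ler_wpM2r ?exprn_ge0 ?ltW//.
by rewrite -natrX ltr_nat ltn_expl.
Qed.

(** The dependence on [n] is only geometric, so the estimate can be summed against rapid
    coefficients. The base [cabs z + 2] leaves, besides [cabs (z + h) <= cabs z + 1], one unit for
    the new term of the induction. *)
Lemma power_second_order (z h : C) n : cabs h <= 1 ->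
  cabs ((z + h) ^+ n - z ^+ n - n%:R * z ^+ n.-1 * h) <= cabs h ^+ 2 * (cabs z + 2) ^+ n.
Proof.
move=> h1; have z0 := cabs_ge0 z.
have bern m : m%:R * cabs z ^+ m.-1 <= (cabs z + 2) ^+ m.
  elim: m => [|m IH]; first by rewrite mul0r.
  rewrite /= exprS mulrDl; case: m IH => [|m] /= IH; first by rewrite !expr0 !mulr1; lra.
  have E : m.+2%:R = m.+1%:R + 1 :> R by rewrite -natr1.
  rewrite E mulrDl mul1r exprS mulrCA; apply: lerD; first by rewrite ler_wpM2l.
  have : cabs z ^+ m.+1 <= (cabs z + 2) ^+ m.+1 by rewrite lerXn2r ?nnegrE//; lra.
  have : 0 <= (cabs z + 2) ^+ m.+1 by rewrite exprn_ge0//; lra.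
  rewrite -exprS; lra.
elim: n => [|n IH].
  by rewrite !expr0 subrr sub0r mul0r mul0r oppr0 cabs0 mulr1 sqr_ge0.
have -> : (z + h) ^+ n.+1 - z ^+ n.+1 - n.+1%:R * z ^+ n.+1.-1 * h =
  (z + h) * ((z + h) ^+ n - z ^+ n - n%:R * z ^+ n.-1 * h) + n%:R * z ^+ n.-1 * h ^+ 2.
  have : n%:R * z ^+ n = n%:R * z ^+ n.-1 * z.
    by case: n {IH} => [|n]; rewrite ?mul0r// -mulrA -exprSr.
  rewrite /= -natr1 !exprS => E.
  have -> : (n%:R + 1) * z ^+ n * h = n%:R * z ^+ n * h + z ^+ n * h by ring.
  by rewrite E; ring.
apply: le_trans (cabsD _ _) _; rewrite !cabsM cabsX -expr2.
have -> : cabs (n%:R : C) = n%:R by rewrite -(rmorph_nat (real_complex R)) cabsR ger0_norm.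
have zh : cabs (z + h) <= cabs z + 1 by apply: le_trans (cabsD _ _) _; rewrite lerD2l.
have b1 : cabs (z + h) * cabs ((z + h) ^+ n - z ^+ n - n%:R * z ^+ n.-1 * h) <=
   (cabs z + 1) * (cabs h ^+ 2 * (cabs z + 2) ^+ n) by apply: ler_pM; rewrite ?cabs_ge0.
have b2 : n%:R * cabs z ^+ n.-1 * cabs h ^+ 2 <= (cabs z + 2) ^+ n * cabs h ^+ 2.
  by rewrite ler_wpM2r ?sqr_ge0.
apply: le_trans (lerD b1 b2) _; rewrite (exprS _ n).
by rewrite le_eqVlt; apply/orP; left; apply/eqP; ring.
Qed.

(** The termwise derivative has an error of at most [2 K |h|^2] for every truncation, hence also in
    the limit. *)
Lemma series_entire (F : C -> C) a : series_of F a -> entire F.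
Proof.
move=> HF; have [ra cF] := HF; apply: cdiff_entire => z.
have [G HG] := series_exists (rapid_shift ra).
exists (G z) => e e0.
(* Twice the base in [power_second_order]: the summed errors form a geometric series of ratio 1/2
   and total [2 * K]. *)
have r0 : 0 < 2 * (cabs z + 2) by have := cabs_ge0 z; lra.
have [K K0 HK] := rapid_bound ra r0.
exists (Num.min 1 (e / (2 * K + 1))); first by rewrite lt_min ltr01 divr_gt0//; lra.
move=> h; rewrite lt_min => /andP[h1 he].
apply: (@le_trans _ _ (cabs h ^+ 2 * (2 * K))); last first.
  rewrite expr2 -mulrA mulrC ler_wpM2r ?cabs_ge0//.
  move: he; rewrite ltr_pdivlMr; last lra.
  have := cabs_ge0 h; nra.
apply/ler_addgt0Pr => d d0.
have d4 : 0 < d / 4 by lra.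
have [N1 H1] := cF (z + h) _ d4; have [N2 H2] := cF z _ d4.
have [N3 H3] := HG.2 z _ d4.
pose n := (N1 + N2 + N3)%N.
have {}H1 : cabs (F (z + h) - psum a n.+1 (z + h)) < d / 4 by apply: H1; rewrite /n; lia.
have {}H2 : cabs (F z - psum a n.+1 z) < d / 4 by apply: H2; rewrite /n; lia.
set b := fun n => _ * _ in HG H3.
have {}H3 : cabs (G z - psum b n z) < d / 4 by apply: H3; rewrite /n; lia.
(* The constant term has no derivative, so [n] terms of [G] match [n.+1] terms of [F]. *)
have E : psum a n.+1 (z + h) - psum a n.+1 z - psum b n z * h =
   \sum_(j < n.+1) a j * ((z + h) ^+ j - z ^+ j - j%:R * z ^+ j.-1 * h).
  have -> : psum b n z * h = \sum_(j < n.+1) a j * (j%:R * z ^+ j.-1 * h).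
    rewrite big_ord_recl /= mul0r mul0r mulr0 add0r mulr_suml.
    by apply: eq_bigr => j _; rewrite /b /bump /= add1n add0n; ring.
  by rewrite /psum -!sumrB; apply: eq_bigr => j _; ring.
have B : cabs (psum a n.+1 (z + h) - psum a n.+1 z - psum b n z * h) <= cabs h ^+ 2 * (2 * K).
  rewrite E; apply: le_trans (cabs_sum _ _ _) _.
  apply: (@le_trans _ _ (\sum_(j < n.+1) cabs h ^+ 2 * (cabs (a j) * (cabs z + 2) ^+ j))).
    apply: ler_sum => j _; rewrite cabsM mulrCA ler_wpM2l ?cabs_ge0//.
    exact/power_second_order/ltW.
  rewrite -mulr_sumr ler_wpM2l ?sqr_ge0//.
  rewrite -(big_mkord predT (fun j => cabs (a j) * (cabs z + 2) ^+ j)).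
  have z2 : 0 < cabs z + 2 by have := cabs_ge0 z; lra.
  have zz : cabs z + 2 < 2 * (cabs z + 2) by lra.
  apply: le_trans (sum_tail_le _ _ (ltW z2) zz K0 HK) _.
  have -> : (cabs z + 2) / (2 * (cabs z + 2)) = 1 / 2 by field; rewrite gt_eqF.
  have -> : 1 - 1 / 2 = 2^-1 :> R by lra.
  by rewrite expr0 mulr1 invrK mulrC.
have -> : F (z + h) - F z - G z * h = (F (z + h) - psum a n.+1 (z + h)) - (F z - psum a n.+1 z)
   - (G z - psum b n z) * h + (psum a n.+1 (z + h) - psum a n.+1 z - psum b n z * h) by ring.
have c1 := cabsD ((F (z + h) - psum a n.+1 (z + h)) - (F z - psum a n.+1 z)
   - (G z - psum b n z) * h) (psum a n.+1 (z + h) - psum a n.+1 z - psum b n z * h).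
have c2 := cabsB ((F (z + h) - psum a n.+1 (z + h)) - (F z - psum a n.+1 z)) ((G z - psum b n z) * h).
have c3 := cabsB (F (z + h) - psum a n.+1 (z + h)) (F z - psum a n.+1 z).
have c4 : cabs ((G z - psum b n z) * h) <= d / 4.
  by rewrite cabsM -[leRHS]mulr1; apply: ler_pM; rewrite ?cabs_ge0 ?ltW.
lra.
Qed.

Lemma entire_series (F : C -> C) : entire F -> exists2 a, series_of F a &
  forall r M n, 0 < r -> circle_bound F r M -> cabs (a n) * r ^+ n <= M.
Proof.
move=> HF; have [a [H1 H2]] := entire_taylor HF.
exists a => //; split.
  by move=> r r0; have [M HM] := circle_bounded HF r; exists M => n; exact: H1.
move=> z e e0; have [M HM] := circle_bounded HF (cabs z + 1).
have r0 : 0 < cabs z + 1 by rewrite ltr_wpDl ?cabs_ge0.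
have zr : cabs z < cabs z + 1 by rewrite ltrDl.
have q01 : 0 <= cabs z / (cabs z + 1) < 1.
  exact: ratio01 (cabs_ge0 _) _.
have [N HN] := geometric_lt (M / (1 - cabs z / (cabs z + 1))) q01 e0.
by exists N => n /HN; apply: le_lt_trans; exact: H2.
Qed.

Lemma series_fourier_coef (F : C -> C) a w k : series_of F a ->
  ci 0 (2 * pi) (fun t => F (w * expi t) * expi (- (k%:R * t))) = (2 * pi)%:C%C * (a k * w ^+ k).
Proof.
move=> HF; have r0 : 0 < cabs w + 1 by rewrite ltr_wpDl ?cabs_ge0.
have wr : cabs w < cabs w + 1 by rewrite ltrDl.
have [K K0 HK] := rapid_bound HF.1 r0.
apply: (@fourier_coef _ _ _ _ (K / (1 - cabs w / (cabs w + 1))) (cabs w / (cabs w + 1))).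
- exact: ratio01 (cabs_ge0 _) _.
- exact/ccont_circle/series_entire/HF.
- move=> n t _.
  have := @series_tail F a (cabs w + 1) K (w * expi t) n HF.
  by rewrite cabsM expi_cabs mulr1 => /(_ wr K0 HK).
Qed.

End PowerSeries.

(** * Growth and coefficients *)

Section LimSup.
Variable R : realType.
Context {T : choiceType} {X : filteredType T}.

Lemma limf_esup_lt (f : X -> \bar R) (F : set (set X)) (A : \bar R) :
  (limf_esup f F < A)%E -> exists2 V, F V & forall x, V x -> (f x < A)%E.
Proof.
rewrite limf_esupE => /ereal_inf_lt [_ [V FV <-] h]; exists V => // x Vx.
by apply: le_lt_trans h; apply: ereal_sup_ubound; exists x.
Qed.

Lemma limf_esup_le (f : X -> \bar R) (F : set (set X)) (A : \bar R) V :
  F V -> (forall x, V x -> (f x <= A)%E) -> (limf_esup f F <= A)%E.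
Proof.
move=> FV H; rewrite limf_esupE.
apply: (@le_trans _ _ (ereal_sup (f @` V))); first by apply: ereal_inf_lbound; exists V.
by apply: ub_ereal_sup => _ [x Vx <-]; exact: H.
Qed.
End LimSup.

Section Growth.
Variable R : realType.
Local Notation C := (R[i]).
Variable rho : R.
Hypothesis rho_gt0 : 0 < rho.

Lemma limn_esup_lt (u : nat -> R) (A : R) : (limn_esup (fun n => (u n)%:E) < A%:E)%E ->
  exists N : nat, forall n, (N <= n)%N -> u n < A.
Proof.
move=> /(@limf_esup_lt _ _ nat)[V [N _ HN] H]; exists N => n Nn.
by rewrite -lte_fin; apply: H; exact: HN.
Qed.

Lemma limn_esup_le (u : nat -> R) (A : R) N : (forall n, (N <= n)%N -> u n <= A) ->
  (limn_esup (fun n => (u n)%:E) <= A%:E)%E.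
Proof.
move=> H; apply: (@limf_esup_le _ _ nat _ _ _ [set n | (N <= n)%N]); first by exists N.
by move=> n /= /H; rewrite lee_fin.
Qed.

Lemma limr_esup_lt (u : R -> R) (A : R) : (limf_esup (fun r => (u r)%:E) +oo%R < A%:E)%E ->
  exists N : R, forall r, N < r -> u r < A.
Proof.
move=> /(@limf_esup_lt _ _ R)[V [N [_ HN]] H]; exists N => n Nn.
by rewrite -lte_fin; apply: H; exact: HN.
Qed.

Lemma limr_esup_le (u : R -> R) (A : R) N : (forall r, N < r -> u r <= A) ->
  (limf_esup (fun r => (u r)%:E) +oo%R <= A%:E)%E.
Proof.
move=> H; apply: (@limf_esup_le _ _ R _ _ _ [set r | N < r]).
  by exists N; split => //; exact: num_real.
by move=> n /= /H; rewrite lee_fin.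
Qed.

(** Fits limits superior, possibly infinite a priori: a strict bound [x < A] yields eventual
    inequalities and eventual inequalities yield [x <= A]. Lower cuts need only be tested at
    positive [A], the range in which [gmaj] is meaningful. *)
Lemma ereal_eq_by_cuts (x : \bar R) (s : R) : 0 < s ->
  (forall A, 0 < A -> (x < A%:E)%E -> s <= A) ->
  (forall A, s < A -> (x <= A%:E)%E) -> x = s%:E.
Proof.
move=> s0 H1 H2; apply/eqP; rewrite eq_le; apply/andP; split.
  by apply/lee_addgt0Pr => e e0; rewrite -EFinD H2// ltrDl.
rewrite leNgt; apply/negP => xs.
have [A A0 [xA As]] : exists2 A, 0 < A & (x < A%:E)%E /\ A < s.
  case: x xs {H1 H2} => [x| |]; rewrite ?lte_fin => xs.
  - exists (Num.max ((x + s) / 2) (s / 2)); first by rewrite lt_max; lra.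
    by rewrite lte_fin lt_max gt_max; split; lra.
  - by [].
  - by exists (s / 2); [lra|split; [rewrite ltNyr|lra]].
by have := H1 A A0 xA; lra.
Qed.

Lemma le_ln1 (u : R) : 0 < u -> ln u <= u - 1.
Proof.
by move=> u0; rewrite -ler_expR lnK// -[leLHS](subrKC 1); exact: expR_ge1Dx.
Qed.

(* [(e rho A / n)^(n / rho)], the minimum over [r] of [r^(-n) exp (A r^rho)]. *)
Definition gmaj (A : R) (n : nat) : R :=
  expR (n%:R / rho * (1 + ln (rho * A / n%:R))).

Lemma gmaj_gt0 A n : 0 < gmaj A n. Proof. exact: expR_gt0. Qed.

Lemma powR_root_lt (y r d : R) : 0 < d -> 0 <= y -> y `^ d^-1 < r -> y < r `^ d.
Proof.
move=> d0 y0 yr; have r0 : 0 < r by exact: le_lt_trans (powR_ge0 _ _) yr.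
rewrite -[ltLHS](powRr1 y0) -(mulVf (lt0r_neq0 d0)) powRrM.
by apply: gt0_ltr_powR; rewrite ?nnegrE ?powR_ge0// ltW.
Qed.

Lemma exprn_expR (r : R) n : 0 < r -> r ^+ n = expR (n%:R * ln r).
Proof. by move=> r0; rewrite expRM_natl lnK. Qed.

Lemma powR_expR (r x : R) : 0 < r -> r `^ x = expR (x * ln r).
Proof. by move=> r0; rewrite /powR gt_eqF. Qed.

(** This is [ln u <= u - 1] at [u = A r^rho / (n / rho)], with equality at the radius where [u = 1],
    the one used in [gmaj_attained]. *)
Lemma gmaj_le A n r : 0 < A -> 0 < r -> gmaj A n * r ^+ n <= expR (A * r `^ rho).
Proof.
move=> A0 r0; case: n => [|n].
  by rewrite /gmaj !mul0r expR0 mul1r expr0 -expR0 ler_expR mulr_ge0 ?powR_ge0 ?ltW.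
rewrite exprn_expR// /gmaj -expRD ler_expR powR_expR//.
set m := n.+1%:R; have m0 : 0 < m :> R by rewrite ltr0n.
set y := A * expR (rho * ln r); have y0 : 0 < y by rewrite mulr_gt0// expR_gt0.
have x0 : 0 < m / rho by rewrite divr_gt0.
have E : ln (y / (m / rho)) = ln (rho * A / m) + rho * ln r.
  have -> : y / (m / rho) = (rho * A / m) * expR (rho * ln r).
    by rewrite /y; field; rewrite !gt_eqF.
  by rewrite lnM ?posrE ?expR_gt0 ?divr_gt0 ?mulr_gt0// expRK.
have := le_ln1 (divr_gt0 y0 x0); rewrite E => H.
have := ler_wpM2l (ltW x0) H.
have -> : m / rho * (y / (m / rho) - 1) = y - m / rho by field; rewrite !gt_eqF.
have -> : m * ln r = m / rho * (rho * ln r) by field; rewrite gt_eqF.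
move: (m / rho) (ln (rho * A / m)) (rho * ln r) => x p q; lra.
Qed.

Lemma gmaj_attained A n : 0 < A -> (0 < n)%N ->
  let r := (n%:R / (rho * A)) `^ rho^-1 in expR (A * r `^ rho) / r ^+ n = gmaj A n.
Proof.
move=> A0 n0 r; set m : R := n%:R; have m0 : 0 < m :> R by rewrite ltr0n.
have x0 : 0 < m / (rho * A) by rewrite divr_gt0// mulr_gt0.
have r0 : 0 < r by rewrite powR_gt0.
have -> : A * r `^ rho = m / rho.
  rewrite /r -powRrM mulVf ?gt_eqF// powRr1 ?ltW//.
  by field; rewrite !gt_eqF.
rewrite exprn_expR// -expRN -expRD /gmaj; congr expR.
have -> : ln r = - (ln (rho * A / m) / rho).
  rewrite /r ln_powR -/m -(invf_div (rho * A) m) lnV ?posrE ?divr_gt0 ?mulr_gt0//.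
  by rewrite mulrN mulrC.
by rewrite -/m; field; rewrite gt_eqF.
Qed.

(** The bridge from the rate in the theorem to [gmaj]: the left-hand side increases with [x] and
    equals [A] at [x = gmaj A n]. *)
Lemma le_gmaj A n (x : R) : 0 < A -> (0 < n)%N -> 0 <= x ->
  (n%:R / (expR 1 * rho) * x `^ (rho / n%:R) <= A) = (x <= gmaj A n).
Proof.
move=> A0 n0 x0; set m := n%:R; have m0 : 0 < m :> R by rewrite ltr0n.
have p0 : 0 < rho / m by rewrite divr_gt0.
have c0 : 0 < m / (expR 1 * rho) by rewrite divr_gt0// mulr_gt0// expR_gt0.
have E : m / (expR 1 * rho) * gmaj A n `^ (rho / m) = A.
  rewrite /gmaj -expRM -/m.
  have -> : m / rho * (1 + ln (rho * A / m)) * (rho / m) = 1 + ln (rho * A / m).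
    by field; rewrite !gt_eqF.
  rewrite expRD lnK ?posrE ?divr_gt0 ?mulr_gt0//.
  by field; rewrite !gt_eqF// expR_gt0.
have g0 := gmaj_gt0 A n.
apply/idP/idP => [h|h].
  rewrite leNgt; apply/negP => gx.
  have := @gt0_ltr_powR R _ p0 (gmaj A n) x; rewrite !nnegrE => /(_ (ltW g0) x0 gx).
  by rewrite -(ltr_pM2l c0) E ltNge h.
have := @ge0_ler_powR R _ (ltW p0) x (gmaj A n); rewrite !nnegrE => /(_ x0 (ltW g0) h).
by rewrite -(ler_pM2l c0) E.
Qed.

Definition gbounded (u : nat -> R) (A : R) := exists N : nat, forall n, (N <= n)%N -> u n <= gmaj A n.

(** [q = (A / B)^(1 / rho)]. This geometric gain pays for every loss in the comparisons below. *)
Lemma gmaj_ratio A B : 0 < A -> A < B -> exists q : R, 0 < q < 1 /\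
  forall n, gmaj A n = q ^+ n * gmaj B n.
Proof.
move=> A0 AB; have B0 : 0 < B by exact: lt_trans AB.
exists (expR (ln (A / B) / rho)); split.
  rewrite expR_gt0/= expR_lt1 pmulr_llt0 ?invr_gt0//.
  by apply: ln_lt0; rewrite divr_gt0//= ltr_pdivrMr// mul1r.
case=> [|n]; first by rewrite expr0 mul1r /gmaj !mul0r.
rewrite -expRM_natl /gmaj -expRD; congr expR.
set m := n.+1%:R; have m0 : 0 < m :> R by rewrite ltr0n.
have -> : rho * A / m = (A / B) * (rho * B / m) by field; rewrite !gt_eqF.
rewrite [ln (A / B * _)]lnM ?posrE ?divr_gt0 ?mulr_gt0//.
by field; rewrite !gt_eqF.
Qed.

Lemma finite_max (u : nat -> R) N : exists M, 0 <= M /\ forall n, (n < N)%N -> u n <= M.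
Proof.
elim: N => [|N [M [M0 H]]]; first by exists 0.
exists (M + `|u N|); split; first by rewrite addr_ge0.
move=> n; rewrite ltnS leq_eqVlt => /predU1P[->|/H h].
  by apply: le_trans (ler_norm _) _; rewrite lerDr.
by apply: le_trans h _; rewrite lerDl.
Qed.

Lemma gbounded_all u A : (forall n, 0 <= u n) -> gbounded u A ->
  exists2 K, 1 <= K & forall n, u n <= K * gmaj A n.
Proof.
move=> u0 [N HN]; have [M [M0 HM]] := finite_max (fun n => u n / gmaj A n) N.
exists (M + 1); first by rewrite lerDr.
move=> n; have g0 := gmaj_gt0 A n; have [nN|Nn] := ltnP n N.
  by rewrite -ler_pdivrMr//; apply: le_trans (HM _ nN) _; rewrite lerDl.
by apply: le_trans (HN _ Nn) _; rewrite -[leLHS]mul1r ler_pM2r// lerDr.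
Qed.

Lemma gbounded_rapid u A : 0 < A -> (forall n, 0 <= u n) -> gbounded u A -> rapid u.
Proof.
move=> A0 u0 /(gbounded_all u0)[K K1 HK] r r0; exists (K * expR (A * r `^ rho)) => n.
apply: (@le_trans _ _ (K * gmaj A n * r ^+ n)); first by rewrite ler_pM2r ?exprn_gt0.
by rewrite -mulrA ler_wpM2l ?gmaj_le//; lra.
Qed.

(** Tails starting at [n] are compared with their first term, so the constant must be 1 for every
    large starting index [n]. *)
Lemma gmaj_decay A s : 0 < A -> 0 < s -> exists N : nat, forall n k, (N <= n)%N -> (n <= k)%N ->
  gmaj A k <= gmaj A n * s ^+ (k - n).
Proof.
(* [n > c] means [1 + ln (rho A / n) < rho ln s]. *)
move=> A0 s0; pose c := rho * A * expR (1 - rho * ln s).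
have c0 : 0 < c by rewrite mulr_gt0 ?expR_gt0// mulr_gt0.
exists (Num.truncn c).+1 => n k Nn nk.
have cn : c < n%:R.
  by apply: lt_le_trans (truncnS_gt _) _; rewrite ler_nat.
have n0 : 0 < n%:R :> R by exact: lt_trans cn.
have k0 : 0 < k%:R :> R by apply: lt_le_trans n0 _; rewrite ler_nat.
rewrite exprn_expR// /gmaj -expRD ler_expR natrB//.
set Ln := ln (rho * A / n%:R); set Lk := ln (rho * A / k%:R).
have rA : 0 < rho * A by rewrite mulr_gt0.
have L1 : Lk <= Ln.
  rewrite ler_ln ?posrE ?divr_gt0// ler_pM2l// lef_pV2 ?posrE//.
  by rewrite ler_nat.
have L2 : 1 + Ln <= rho * ln s.
  have : rho * A / n%:R <= expR (rho * ln s - 1).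
    rewrite ler_pdivrMr//; apply: ltW; move: cn; rewrite /c.
    by rewrite -(opprB (rho * ln s)) expRN ltr_pdivrMr ?expR_gt0// (mulrC n%:R).
  by move=> h; rewrite -lerBrDl -ler_expR lnK ?posrE ?divr_gt0.
have kn : n%:R <= k%:R :> R by rewrite ler_nat.
have -> : n%:R / rho * (1 + Ln) + (k%:R - n%:R) * ln s =
   k%:R / rho * (1 + Ln) + (k%:R - n%:R) / rho * (rho * ln s - (1 + Ln)).
  by field; rewrite gt_eqF.
have h1 : k%:R / rho * (1 + Lk) <= k%:R / rho * (1 + Ln).
  by rewrite ler_wpM2l ?lerD2l// divr_ge0 ?ltW.
have h2 : 0 <= (k%:R - n%:R) / rho * (rho * ln s - (1 + Ln)).
  by rewrite mulr_ge0 ?subr_ge0// divr_ge0 ?subr_ge0// ltW.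
lra.
Qed.

(** * Maximum modulus, type and order in terms of the coefficients *)

Section EntireGrowth.
Variables (F : C -> C) (a : nat -> C).
Hypothesis HF : series_of F a.

(** The [sup] in [maxmod] dominates the values on the circle only once they are known to be
    bounded. *)
Lemma maxmod_has_ubound r : 0 <= r -> exists B, forall z : C, cabs z = r -> cabs (F z) <= B.
Proof.
move=> r0; have r1 : 0 < r + 1 by rewrite ltr_wpDl.
have [K K0 HK] := rapid_bound HF.1 r1.
exists (K / (1 - r / (r + 1))) => z zr.
have := @series_tail R F a (r + 1) K z 0 HF.
rewrite zr expr0 mulr1 /psum big_ord0 subr0; apply => //.
by rewrite ltrDl.
Qed.

Lemma maxmod_ge r z : cabs z = r -> cabs (F z) <= maxmod F r.
Proof.
move=> zr; have r0 : 0 <= r by rewrite -zr cabs_ge0.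
have [B HB] := maxmod_has_ubound r0.
by apply: ub_le_sup; [exists B => _ [w wr <-]; exact: HB|exists z].
Qed.

Lemma maxmod_le r B : 0 <= r -> (forall z : C, cabs z = r -> cabs (F z) <= B) -> maxmod F r <= B.
Proof.
move=> r0 HB; apply: ge_sup; last by move=> _ [w wr <-]; exact: HB.
by exists (cabs (F r%:C%C)), r%:C%C => //; rewrite /mkset cabsR ger0_norm.
Qed.

Lemma maxmod_ge0 r : 0 <= r -> 0 <= maxmod F r.
Proof.
move=> r0; apply: le_trans (maxmod_ge (z := r%:C%C) _); first exact: cabs_ge0.
by rewrite cabsR ger0_norm.
Qed.

Lemma maxmod_lt_expR r B : 0 <= r -> 0 <= B -> ln (maxmod F r) <= B -> maxmod F r <= expR B.
Proof.
move=> r0 B0 h; have := maxmod_ge0 r0; rewrite le_eqVlt => /predU1P[<-|M0].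
  exact: expR_ge0.
by rewrite -(lnK M0) ler_expR.
Qed.

(** If the maximum modulus vanishes, [ln] takes its default value 0, and [0 <= B] covers this
    case. *)
Lemma ln_maxmod_le r B : 0 <= r -> 0 <= B -> maxmod F r <= expR B -> ln (maxmod F r) <= B.
Proof.
move=> r0 B0 h; have := maxmod_ge0 r0; rewrite le_eqVlt => /predU1P[<-|M0].
  by rewrite ln0.
by rewrite -ler_expR lnK.
Qed.

Hypothesis cauchy_est : forall r M n, 0 < r -> circle_bound F r M -> cabs (a n) * r ^+ n <= M.

(** Cauchy's estimate at the optimal radius of [gmaj_attained], which grows with [n] into the range
    where [M(r) <= exp (A r^rho)]. *)
Lemma type_lt_gbounded A : 0 < A -> (type_of F rho < A%:E)%E -> gbounded (fun n => cabs (a n)) A.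
Proof.
move=> A0 /limr_esup_lt[r0 Hr].
(* [n > c] puts the optimal radius beyond [|r0| + 1]. *)
pose c := rho * A * (`|r0| + 1) `^ rho.
have rA : 0 < rho * A by rewrite mulr_gt0.
exists (Num.truncn c).+1 => n Nn.
have cn : c < n%:R by apply: lt_le_trans (truncnS_gt _) _; rewrite ler_nat.
have n0 : (0 < n)%N by exact: leq_trans Nn.
rewrite -(gmaj_attained A0 n0); set r := (n%:R / (rho * A)) `^ rho^-1.
have x0 : 0 < n%:R / (rho * A) by rewrite divr_gt0// ltr0n.
have rp : 0 < r by rewrite powR_gt0.
have rr : r0 < r.
  apply: le_lt_trans (ler_norm _) _; apply: (@lt_trans _ _ (`|r0| + 1)); first by rewrite ltrDl.
  have b0 : 0 <= `|r0| + 1 by rewrite addr_ge0.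
  apply: powR_root_lt; rewrite ?invr_gt0 ?invrK//.
  by rewrite ltr_pdivlMr// mulrC.
rewrite ler_pdivlMr ?exprn_gt0//.
apply: cauchy_est => // t _; apply: (@le_trans _ _ (maxmod F r)).
  by apply: maxmod_ge; rewrite cabsM expi_cabs mulr1 cabsR gtr0_norm.
apply: maxmod_lt_expR; [exact: ltW|by rewrite ltW// mulr_gt0// powR_gt0|].
by rewrite -ler_pdivrMr ?powR_gt0// ltW// Hr.
Qed.

(** With [A < A1 < B], the step from [A] to [A1] makes the series of terms [gmaj A j * r ^+ j]
    geometric, so [M(r) <= L exp (A1 r^rho)]; the step from [A1] to [B] absorbs [L]. *)
Lemma gbounded_type_le A B : 0 < A -> A < B -> gbounded (fun n => cabs (a n)) A ->
  (type_of F rho <= B%:E)%E.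
Proof.
move=> A0 AB gb; pose A1 := (A + B) / 2.
have AA1 : A < A1 by rewrite /A1; lra.
have A1B : A1 < B by rewrite /A1; lra.
have A10 : 0 < A1 by exact: lt_trans AA1.
have [q [/andP[q0 q1] qE]] := gmaj_ratio A0 AA1.
have [K K1 HK] := gbounded_all (fun n => cabs_ge0 (a n)) gb.
have q10 : 0 < 1 - q by rewrite subr_gt0.
have K0 : 0 < K by exact: lt_le_trans K1.
pose L := K / (1 - q); have L0 : 0 < L by rewrite divr_gt0.
have L1 : 1 <= L by rewrite ler_pdivlMr//; lra.
have bound r : 0 < r -> maxmod F r <= L * expR (A1 * r `^ rho).
  move=> r0; apply: maxmod_le; first exact: ltW.
  move=> z zr; apply/ler_addgt0Pr => e e0; have [N HN] := HF.2 z e e0.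
  rewrite -[F z](subrK (psum a N z)) addrC; apply: le_trans (cabsD _ _) _.
  apply: lerD; last by apply/ltW/HN.
  apply: le_trans (cabs_sum _ _ _) _.
  apply: (@le_trans _ _ (\sum_(j < N) (K * expR (A1 * r `^ rho)) * q ^+ j)).
    apply: ler_sum => j _; rewrite cabsM cabsX zr.
    apply: (@le_trans _ _ (K * gmaj A j * r ^+ j)); first by rewrite ler_pM2r ?exprn_gt0.
    rewrite qE; set E := expR _.
    have -> : K * (q ^+ j * gmaj A1 j) * r ^+ j = K * q ^+ j * (gmaj A1 j * r ^+ j) by ring.
    have -> : K * E * q ^+ j = K * q ^+ j * E by ring.
    by rewrite ler_wpM2l ?gmaj_le// mulr_ge0 ?exprn_ge0// ltW.
  rewrite -mulr_sumr -(big_mkord predT (fun j => q ^+ j)).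
  have := @geom_sum_le R q 0 N; rewrite (ltW q0) q1 expr0 => /(_ isT) h.
  have -> : L * expR (A1 * r `^ rho) = (K * expR (A1 * r `^ rho)) * (1 / (1 - q)).
    by rewrite /L; field; rewrite gt_eqF.
  by rewrite ler_wpM2l// mulr_ge0 ?expR_ge0 ?ltW.
have lL : 0 <= ln L by exact: ln_ge0.
(* [r^rho > x] means [ln L + A1 r^rho < B r^rho]. *)
pose x := ln L / (B - A1).
apply: (@limr_esup_le _ _ ((x + 1) `^ rho^-1)) => r rx.
have x1 : 0 < x + 1 by rewrite ltr_wpDl// divr_ge0// subr_ge0 ltW.
have r0 : 0 < r by apply: lt_trans rx; rewrite powR_gt0.
have rr : 0 < r `^ rho by rewrite powR_gt0.
rewrite ler_pdivrMr//; apply: ln_maxmod_le; first exact: ltW.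
  by rewrite ltW// mulr_gt0//; exact: lt_trans A1B.
apply: (le_trans (bound r r0)).
rewrite -[leLHS]mulrC -[X in _ * X](lnK L0) -expRD ler_expR.
have : x < r `^ rho.
  apply: (@lt_trans _ _ (x + 1)); first by rewrite ltrDl.
  exact: powR_root_lt (ltW x1) rx.
rewrite ltr_pdivrMr ?subr_gt0//; nra.
Qed.

Lemma type_order sigma : 0 < sigma -> type_of F rho = sigma%:E -> order_of F = rho%:E.
Proof.
move=> s0 HT; apply: ereal_eq_by_cuts => // B B0.
- move=> /limr_esup_lt[r0 Hr]; rewrite leNgt; apply/negP => Brho.
  have : (type_of F rho <= (sigma / 2)%:E)%E; last by rewrite HT lee_fin; lra.
  pose d := rho - B; have d0 : 0 < d by rewrite subr_gt0.
  (* Beyond this radius [r^d > 2 / sigma], so [r^B <= (sigma / 2) r^rho] and the type would be at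
     most [sigma / 2]. *)
  pose x := (2 / sigma + 1) `^ d^-1.
  have y0 : 0 < 2 / sigma + 1 by rewrite ltr_wpDl// divr_ge0 ?ltW.
  apply: (@limr_esup_le _ _ (Num.max r0 (Num.max x 1))) => r.
  rewrite !gt_max => /and3P[rr0 rx r1].
  have rp : 0 < r by exact: lt_trans r1.
  have lr : 0 < ln r by exact: ln_gt0.
  have h := Hr r rr0; rewrite ltr_pdivrMr// in h.
  have lM : ln (maxmod F r) <= r `^ B.
    have [M0|M0] := leP (ln (maxmod F r)) 0; first by apply: le_trans M0 _; exact: powR_ge0.
    by rewrite -(lnK M0) powR_expR// ler_expR ltW.
  rewrite ler_pdivrMr ?powR_gt0//; apply: le_trans lM _.
  have -> : r `^ rho = r `^ B * r `^ d.
    by rewrite -powRD ?gt_eqF ?implybT// /d addrC subrK.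
  rewrite mulrCA ler_peMr ?powR_ge0//.
  have : 2 / sigma < r `^ d.
    apply: (@lt_trans _ _ (2 / sigma + 1)); first by rewrite ltrDl.
    exact: powR_root_lt (ltW y0) rx.
  by rewrite ltr_pdivrMr// => h2; lra.
- have /limr_esup_lt[r0 Hr] : (type_of F rho < (2 * sigma)%:E)%E.
    by rewrite HT lte_fin; lra.
  pose y := `|ln (2 * sigma)| / (B - rho).
  apply: (@limr_esup_le _ _ (Num.max r0 (Num.max (expR y) 1))) => r.
  rewrite !gt_max => /and3P[rr0 rx r1].
  have rp : 0 < r by exact: lt_trans r1.
  have lr : 0 < ln r by exact: ln_gt0.
  rewrite ler_pdivrMr//.
  (* Where [ln M(r) <= 0], the outer logarithm has its default value 0, which is below
     [B * ln r]. *)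
  have [M0|M0] := leP (ln (maxmod F r)) 0; first by rewrite ln0// ltW// mulr_gt0//; exact: lt_trans B0.
  have h := Hr r rr0; rewrite ltr_pdivrMr ?powR_gt0// in h.
  have s2 : 0 < 2 * sigma by rewrite mulr_gt0.
  apply: (@le_trans _ _ (ln (2 * sigma * r `^ rho))).
    by rewrite ler_ln ?posrE ?mulr_gt0 ?powR_gt0// ltW.
  rewrite lnM ?posrE ?powR_gt0// ln_powR.
  have : y < ln r by rewrite -ltr_expR lnK.
  rewrite ltr_pdivrMr ?subr_gt0// => hy.
  have := ler_norm (ln (2 * sigma)); nra.
Qed.

End EntireGrowth.
End Growth.

(** * Best approximation in the function space *)

Section SeriesOperations.
Variable R : realType.
Local Notation C := (R[i]).

Lemma entire_exprn n : entire (fun z : C => z ^+ n).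
Proof.
apply: cdiff_entire => z; exists (n%:R * z ^+ n.-1) => e e0.
have Z0 : 0 < (cabs z + 2) ^+ n by rewrite exprn_gt0// ltr_wpDl ?cabs_ge0.
exists (Num.min 1 (e / (cabs z + 2) ^+ n)); first by rewrite lt_min ltr01 divr_gt0.
move=> h; rewrite lt_min => /andP[/ltW h1 he].
apply: le_trans (power_second_order _ _ h1) _.
rewrite expr2 -mulrA mulrC ler_wpM2r ?cabs_ge0//.
by move: he; rewrite ltr_pdivlMr// => /ltW.
Qed.

Lemma seriesB (F G : C -> C) a b : series_of F a -> series_of G b ->
  series_of (fun z => F z - G z) (fun n => a n - b n).
Proof.
move=> [ra HF] [rb HG]; split.
  move=> r r0; have [K HK] := ra r r0; have [L HL] := rb r r0; exists (K + L) => n.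
  apply: le_trans (lerD (HK n) (HL n)); rewrite -mulrDl ler_wpM2r ?cabsB//.
  by rewrite exprn_ge0// ltW.
move=> z e e0; have e2 : 0 < e / 2 by lra.
have [N HN] := HF z _ e2; have [M HM] := HG z _ e2; exists (N + M)%N => n nNM.
have -> : psum (fun n => a n - b n) n z = psum a n z - psum b n z.
  by rewrite /psum -sumrB; apply: eq_bigr => j _; rewrite mulrBl.
have -> : F z - G z - (psum a n z - psum b n z) = (F z - psum a n z) - (G z - psum b n z) by ring.
apply: le_lt_trans (cabsB _ _) _.
have := HN n ltac:(lia); have := HM n ltac:(lia); lra.
Qed.

Lemma series_psum (b : nat -> C) n : series_of (psum b n) (fun j => if (j < n)%N then b j else 0).
Proof.
have P m z : (n <= m)%N -> psum (fun j => if (j < n)%N then b j else 0) m z = psum b n z.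
  move=> nm; set b' := fun j => _; rewrite -(subrK (psum b' n z) (psum b' m z)) psumB//.
  rewrite big_nat_cond big1 ?add0r => [|j /andP[/andP[nj _] _]]; last first.
    by rewrite /b' ltnNge nj mul0r.
  by apply: eq_bigr => j _; rewrite /b' ltn_ord.
split=> [r r0|z e e0].
  have [M [M0 HM]] := finite_max (fun j => cabs (b j) * r ^+ j) n.
  by exists M => j; case: ifP => [/HM//|_]; rewrite cabs0 mul0r.
by exists n => m nm; rewrite P// subrr cabs0.
Qed.

Lemma series_dilate (F : C -> C) a (c : R) : 0 < c -> series_of F a ->
  series_of (fun z => F (c%:C%C * z)) (fun n => a n * c%:C%C ^+ n).
Proof.
move=> c0 [ra HF]; split=> [r r0|z e e0].
  have [K HK] := ra (c * r) (mulr_gt0 c0 r0); exists K => n.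
  by rewrite cabsM cabsX cabsR gtr0_norm// -mulrA -exprMn.
have [N HN] := HF (c%:C%C * z) e e0; exists N => n /HN.
rewrite /psum; congr (cabs (_ - _) < _); apply: eq_bigr => j _.
by rewrite exprMn mulrA.
Qed.

Lemma poly_psum (p : {poly C}) n : (size p <= n)%N -> horner p = psum (fun j => p`_j) n.
Proof. by move=> sp; apply/funext => z; rewrite (horner_coef_wide _ sp). Qed.

Lemma sum_nat_shift (f : nat -> C) m N :
  \sum_(m <= j < N) f j = \sum_(k < N - m) f (k + m)%N.
Proof. by rewrite -{1}(add0n m) big_addn big_mkord. Qed.

Lemma ccont_cabs (g : R -> C) : ccont g -> continuous (fun t => cabs (g t)).
Proof.
move=> [g1 g2] t.
have -> : (fun t => cabs (g t)) = (fun t => Num.sqrt (complex.Re (g t) ^+ 2 + complex.Im (g t) ^+ 2)).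
  by apply/funext => s; case: (g s).
apply: (@continuous_comp _ _ _ (fun t => complex.Re (g t) ^+ 2 + complex.Im (g t) ^+ 2)); last exact: sqrt_continuous.
by apply: cvgD; apply: cvgM; [exact: g1|exact: g1|exact: g2|exact: g2].
Qed.

End SeriesOperations.

Section FunctionSpace.
Variables (R : realType) (inX : set (R[i] -> R[i])) (nX : (R[i] -> R[i]) -> R).
Hypothesis HX : funBanach inX nX.
Local Notation C := (R[i]).
Local Notation w := (nXmono nX).

Definition cconv (f : C -> C) (g : R -> C) (z : C) : C :=
  (((2 * pi)^-1)%:C)%C * ci 0 (2 * pi) (fun t => f (z * expi t) * g t).

Lemma cconv_X f g B : inX f -> ccont g -> (forall t, cabs (g t) <= B) ->
  inX (cconv f g) /\ nX (cconv f g) <= B * nX f.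
Proof.
move=> Xf cg gB; have pi0 := twopi_gt0 R.
have [_ [H1 H2]] := X_conv HX Xf (ccont_cintg 0 (2 * pi) cg).
split => //; apply: (le_trans H2); rewrite ler_wpM2r ?(nX_ge0 HX)//.
rewrite ler_pdivrMl//.
have -> : 2 * pi * B = Rintegral lebesgue_measure `[0, 2 * pi] (fun=> B).
  by rewrite Rintegral_cst//= lebesgue_measure_itv /= lte_fin pi0 /= subr0 mulrC.
apply: le_Rintegral => //.
- apply: continuous_integrable_itv; exact: ccont_cabs.
- by apply: continuous_integrable_itv; exact: cst_continuous.
Qed.

Lemma twopiVK (z : C) : (((2 * pi : R)^-1)%:C)%C * ((2 * pi : R)%:C%C * z) = z.
Proof.
rewrite mulrA -rmorphM /= mulVf ?mul1r//.
by rewrite gt_eqF// twopi_gt0.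
Qed.

Lemma inX_series F a : series_of F a -> inX F.
Proof. by move=> /series_entire; exact: (X_entire HX). Qed.

Lemma w_gt0 n : 0 < w n.
Proof.
have Xn := X_entire HX (@entire_exprn R n).
rewrite lt_neqAle (nX_ge0 HX Xn) andbT eq_sym; apply/eqP => /(nX_eq0 HX Xn) H.
have d : disk (((1 / 2 : R)%:C)%C).
  by rewrite /disk /mkset cabsR ger0_norm; lra.
have /eqP := H _ d; rewrite expf_eq0 => /andP[_].
by rewrite -cabs_eq0 cabsR => /eqP; rewrite ger0_norm; lra.
Qed.

Lemma coef_norm_le F a n : series_of F a -> cabs (a n) * w n <= nX F.
Proof.
move=> HF.
have [_ H] := cconv_X (g := fun t => expi (- (n%:R * t))) (B := 1) (inX_series HF)
  (ccont_expiNk _) (fun t => eq_ind_r (fun x => x <= 1) (lexx 1) (expi_cabs _)).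
rewrite mul1r in H; apply: le_trans H.
have -> : cconv F (fun t => expi (- (n%:R * t))) = (fun z => a n * z ^+ n).
  by apply/funext => z; rewrite /cconv (series_fourier_coef _ _ HF) twopiVK.
by rewrite (nX_scale HX)//; exact: (X_entire HX (@entire_exprn R n)).
Qed.

Lemma nX_psum_diff (a : nat -> C) n m : (n <= m)%N ->
  nX (fun z => psum a m z - psum a n z) <= \sum_(n <= j < m) cabs (a j) * w j.
Proof.
move=> nm.
have -> : (fun z => psum a m z - psum a n z) = (fun z => \sum_(n <= j < m) a j * z ^+ j).
  by apply/funext => z; rewrite psumB.
(* The zero function enters [X] as a multiple of a monomial. *)
have X0 : inX (fun z => 0 * z ^+ 0).
  by apply: (X_scale HX); exact: (X_entire HX (@entire_exprn R 0)).
suff [_ //] : inX (fun z => \sum_(n <= j < m) a j * z ^+ j) /\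
    nX (fun z => \sum_(n <= j < m) a j * z ^+ j) <= \sum_(n <= j < m) cabs (a j) * w j.
elim: m nm => [|m IH] nm.
  rewrite big_geq//; under eq_fun do rewrite big_geq//.
  have -> : (fun=> 0) = (fun z : C => 0 * z ^+ 0) by apply/funext => z; rewrite mul0r.
  split=> //; rewrite (nX_scale HX) ?cabs0 ?mul0r//.
  exact: (X_entire HX (@entire_exprn R 0)).
move: nm; rewrite leq_eqVlt => /predU1P[->|nm].
  rewrite big_geq//; under eq_fun do rewrite big_geq//.
  have -> : (fun=> 0) = (fun z : C => 0 * z ^+ 0) by apply/funext => z; rewrite mul0r.
  split=> //; rewrite (nX_scale HX) ?cabs0 ?mul0r//.
  exact: (X_entire HX (@entire_exprn R 0)).
have [I1 I2] := IH nm.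
have Xm := X_entire HX (@entire_exprn R m).
rewrite big_nat_recr//=; under eq_fun do rewrite big_nat_recr//=.
have Xam := X_scale HX (a m) Xm; split; first exact: (X_add HX I1 Xam).
by apply: le_trans (nX_triangle HX I1 Xam) _; rewrite lerD// (nX_scale HX).
Qed.

(** [geo] is [1 / (1 - gq)], written as a Cauchy kernel with radius 1 and point 1/2 so that its
    continuity is already known. Dilating [F] by 2 is possible because [F] is entire, and the
    modulus 1/2 of [gq] that compensates it gives the decay [2^-m]. *)
Let z2 : C := (1 / 2 : R)%:C%C.
Let z2_lt1 : cabs z2 < 1. Proof. by rewrite cabsR ger0_norm; lra. Qed.
Let geo (t : R) : C := - 'i%C * ((1 : R)%:C%C * ('i%C * expi t) / ((1 : R)%:C%C * expi t - z2)).
Let gq (t : R) : C := z2 * expi (- t).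
Let ccont_geo : ccont geo. Proof. by apply: ccontZ; exact: ccont_cauchy_kernel. Qed.
Let ccont_gq : ccont gq. Proof. by apply: ccontZ; exact: ccont_expiN. Qed.
Let gq_abs t : cabs (gq t) = 1 / 2.
Proof. by rewrite cabsM expi_cabs mulr1 cabsR ger0_norm//; lra. Qed.
Let gq1 t : 1 - gq t != 0.
Proof. rewrite -cabs_gt0; have := cabsD (1 - gq t) (gq t); rewrite subrK cabs1 gq_abs; lra. Qed.
Let geoE t : geo t = (1 - gq t)^-1.
Proof.
have e0 := expi_neq0 t; have g1 := gq1 t.
rewrite /geo rmorph1 !mul1r.
have -> : expi t - z2 = expi t * (1 - gq t) by rewrite /gq expiN mulrBr mulr1 mulrCA divff// mulr1.
have ii : - 'i%C * 'i%C = 1 :> C by rewrite mulNr -expr2 sqr_i opprK.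
rewrite !mulrA ii mul1r invfM mulrA divff// mul1r //.
Qed.
Let geo_abs t : cabs (geo t) <= 2.
Proof.
rewrite geoE cabsV -[leRHS]invrK lef_pV2 ?posrE ?invr_gt0 ?cabs_gt0//.
have := cabsD (1 - gq t) (gq t); rewrite subrK cabs1 gq_abs; lra.
Qed.
Let geo_split m N t : (m <= N)%N ->
  gq t ^+ m * geo t = \sum_(m <= k < N) gq t ^+ k + gq t ^+ N * geo t.
Proof.
move=> mN; rewrite geoE; apply: (mulIf (gq1 t)).
rewrite mulfVK// mulrDl mulfVK// mulr_suml.
have := telescope_sumr (fun j => - gq t ^+ j) mN; rewrite opprK addrC => E.
have -> : \sum_(m <= i < N) gq t ^+ i * (1 - gq t) = gq t ^+ m - gq t ^+ N.
  by rewrite -E; apply: eq_bigr => j _; rewrite exprS; ring.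
by rewrite subrK.
Qed.

(* Norm convergence of the Taylor series cannot be read off pointwise values; it
   comes from writing the remainder as a convolution of [F (2 z)] with the kernel
   [q^m / (1 - q)], [q = e^(-it) / 2]. *)
Lemma remainder_cconv F a m : series_of F a ->
  (fun z => F z - psum a m z) = cconv (fun z => F ((2 : R)%:C%C * z)) (fun t => gq t ^+ m * geo t).
Proof.
move=> HF; apply/funext => z.
have half_ge0 : 0 <= (1 / 2 : R) by lra.
have HG := series_dilate (ltr0Sn R 1) HF; set G := fun z => _ in HG *.
have cG := ccont_circle (series_entire HG) z.
have [M HM] := ccont_bounded 0 (2 * pi) cG.
have M0 : 0 <= M by apply: le_trans (cabs_ge0 _) (HM 0 _); rewrite lexx ltW ?twopi_gt0.
apply/esym/eqP; rewrite -subr_eq0 -cabs_eq0 eq_le cabs_ge0 andbT.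
apply/ler_addgt0Pr => e e0; rewrite add0r.
have e2 : 0 < e / 2 by lra.
have [N1 H1] := HF.2 z _ e2.
have [N2 H2] := @geometric_lt R (M * 2) (1 / 2) (e / 2) ltac:(lra) e2.
pose N := (m + N1 + N2)%N.
have mN : (m <= N)%N by rewrite /N; lia.
have {}H1 := H1 N ltac:(rewrite /N; lia).
have {}H2 := H2 N ltac:(rewrite /N; lia).
have cgk k : ccont (fun t => G (z * expi t) * gq t ^+ k) by apply: ccontM => //; exact: ccontX.
have cr : ccont (fun t => G (z * expi t) * (gq t ^+ N * geo t)).
  by apply: ccontM => //; apply: ccontM => //; exact: ccontX.
(* The factor [2^k] of the dilated coefficient cancels against that of [gq ^+ k]. *)
have Ek k : ci 0 (2 * pi) (fun t => G (z * expi t) * gq t ^+ k) = (2 * pi)%:C%C * (a k * z ^+ k).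
  have -> : (fun t => G (z * expi t) * gq t ^+ k) =
      (fun t => z2 ^+ k * (G (z * expi t) * expi (- (k%:R * t)))).
    by apply/funext => t; rewrite /gq exprMn expiX mulrN mulrCA.
  rewrite ciZ; last by apply: ccont_cintg; apply: ccontM => //; exact: ccont_expiNk.
  rewrite (series_fourier_coef _ _ HG).
  have zz : z2 ^+ k * (2 : R)%:C%C ^+ k = 1.
    by rewrite -exprMn -rmorphM /= mul1r mulVf// expr1n.
  have -> : z2 ^+ k * ((2 * pi)%:C%C * (a k * (2 : R)%:C%C ^+ k * z ^+ k)) =
    (z2 ^+ k * (2 : R)%:C%C ^+ k) * ((2 * pi)%:C%C * (a k * z ^+ k)).
    by move: ((2 * pi)%:C%C) (z2 ^+ k) ((2 : R)%:C%C ^+ k) => x y u; ring.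
  by rewrite zz mul1r.
have E : ci 0 (2 * pi) (fun t => G (z * expi t) * (gq t ^+ m * geo t)) =
    (2 * pi)%:C%C * (psum a N z - psum a m z) + ci 0 (2 * pi) (fun t => G (z * expi t) * (gq t ^+ N * geo t)).
  have -> : (fun t => G (z * expi t) * (gq t ^+ m * geo t)) =
     (fun t => \sum_(k < N - m) G (z * expi t) * gq t ^+ (k + m) + G (z * expi t) * (gq t ^+ N * geo t)).
    apply/funext => t; rewrite (geo_split _ mN) mulrDr mulr_sumr.
    by rewrite sum_nat_shift.
  rewrite ciD; last 2 first.
  - exact: (@cintg_sum R 0 _ (N - m) (fun k t => G (z * expi t) * gq t ^+ (k + m)) (fun k => ccont_cintg _ _ (cgk _))).
  - exact: ccont_cintg.
  rewrite (@ci_sum R 0 _ (N - m) (fun k t => G (z * expi t) * gq t ^+ (k + m)) (fun k => ccont_cintg _ _ (cgk _))).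
  congr (_ + _); rewrite psumB// sum_nat_shift mulr_sumr.
  by apply: eq_bigr => k _; exact: Ek.
rewrite /cconv E mulrDr twopiVK.
set er := _ * ci _ _ _.
have -> : psum a N z - psum a m z + er - (F z - psum a m z) = er - (F z - psum a N z) by ring.
have er2 : cabs er <= e / 2.
  apply: le_trans _ (ltW H2); rewrite /er cabsM cabsR gtr0_norm ?invr_gt0 ?twopi_gt0//.
  rewrite ler_pdivrMl ?twopi_gt0//.
  have -> : 2 * pi * (M * 2 * (1 / 2) ^+ N) = (M * ((1 / 2) ^+ N * 2)) * (2 * pi - 0) by ring.
  apply: ci_bound; [exact/ltW/twopi_gt0|exact: ccont_cintg|].
  move=> t tI; rewrite cabsM (cabsM (gq t ^+ N)) cabsX gq_abs; apply: ler_pM.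
  - exact: cabs_ge0.
  - by apply: mulr_ge0; [exact: exprn_ge0|exact: cabs_ge0].
  - exact: HM.
  - by apply: ler_wpM2l => //; exact: exprn_ge0.
apply: le_trans (cabsB _ _) _; lra.
Qed.

Lemma remainder_cvg F a : series_of F a -> forall e, 0 < e -> exists N : nat,
  forall m, (N <= m)%N -> nX (fun z => F z - psum a m z) < e.
Proof.
move=> HF e e0; have XG := inX_series (series_dilate (ltr0Sn R 1) HF).
have [N HN] := @geometric_lt R (2 * nX (fun z => F ((2 : R)%:C%C * z))) (1 / 2) e ltac:(lra) e0.
exists N => m /HN; apply: le_lt_trans; rewrite (remainder_cconv _ HF).
have cg : ccont (fun t => gq t ^+ m * geo t) by apply: ccontM => //; exact: ccontX.
have gB t : cabs (gq t ^+ m * geo t) <= 2 * (1 / 2) ^+ m.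
  rewrite cabsM cabsX gq_abs mulrC ler_wpM2r//; apply: exprn_ge0; lra.
by have [_] := cconv_X XG cg gB; rewrite mulrAC.
Qed.

Lemma inX_psum a n : inX (psum a n).
Proof. exact: inX_series (series_psum a n). Qed.

Lemma X_sub f g : inX f -> inX g -> inX (fun z => f z - g z).
Proof.
move=> Xf Xg; have := X_add HX Xf (X_scale HX (-1) Xg).
by congr inX; apply/funext => z; rewrite mulN1r.
Qed.

Lemma nX_opp f : inX f -> nX (fun z => - f z) = nX f.
Proof.
move=> Xf; have := nX_scale HX (-1) Xf; rewrite cabsN cabs1 mul1r => <-.
by congr nX; apply/funext => z; rewrite mulN1r.
Qed.

Lemma nX_trans f g h : inX f -> inX g -> inX h ->
  nX (fun z => f z - h z) <= nX (fun z => f z - g z) + nX (fun z => g z - h z).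
Proof.
move=> Xf Xg Xh; apply: le_trans (nX_triangle HX (X_sub Xf Xg) (X_sub Xg Xh)).
rewrite le_eqVlt; apply/orP; left; apply/eqP; congr nX; apply/funext => z; ring.
Qed.

Lemma nX_subC f g : inX f -> inX g -> nX (fun z => f z - g z) = nX (fun z => g z - f z).
Proof.
move=> Xf Xg; rewrite -(nX_opp (X_sub Xg Xf)).
by congr nX; apply/funext => z; rewrite opprB.
Qed.

Lemma remainder_le F a n B : series_of F a ->
  (forall m, (n <= m)%N -> \sum_(n <= j < m) cabs (a j) * w j <= B) ->
  nX (fun z => F z - psum a n z) <= B.
Proof.
move=> HF HB; apply/ler_addgt0Pr => e e0; have [N HN] := remainder_cvg HF e0.
have nN : (n <= maxn N n)%N by exact: leq_maxr.
apply: le_trans (nX_trans (inX_series HF) (inX_psum a (maxn N n)) (inX_psum a n)) _.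
rewrite addrC lerD//; last by apply/ltW/HN; exact: leq_maxl.
by apply: le_trans (nX_psum_diff _ nN) _; exact: HB.
Qed.

Lemma bestE_le f n (p : {poly C}) : inX f -> (size p <= n)%N ->
  bestE nX f n <= nX (fun z => f z - p.[z]).
Proof.
move=> Xf sp; apply: ge_inf; last by exists p.
exists 0 => _ [q sq <-]; apply: (nX_ge0 HX); apply: X_sub => //.
by rewrite (poly_psum sq); exact: inX_psum.
Qed.

Lemma bestE_ge f n B : (forall p : {poly C}, (size p <= n)%N -> B <= nX (fun z => f z - p.[z])) ->
  B <= bestE nX f n.
Proof.
move=> H; apply: lb_le_inf; first by exists (nX (fun z => f z - (0 : {poly C}).[z])), 0 => //=; rewrite size_poly0.
by move=> _ [p sp <-]; exact: H.
Qed.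

Lemma bestE_ge0 f n : inX f -> 0 <= bestE nX f n.
Proof.
move=> Xf; apply: bestE_ge => p sp; apply: (nX_ge0 HX); apply: X_sub => //.
by rewrite (poly_psum sp); exact: inX_psum.
Qed.

(** A polynomial of size at most [n] has no coefficient of index [n], so subtracting it leaves [a n]
    unchanged. *)
Lemma coef_le_bestE F a n : series_of F a -> cabs (a n) * w n <= bestE nX F n.
Proof.
move=> HF; apply: bestE_ge => p sp.
have := coef_norm_le n (seriesB HF (series_psum (fun j => p`_j) n)).
by rewrite ltnn subr0 -(poly_psum sp).
Qed.

Lemma bestE_le_remainder F a n : series_of F a ->
  bestE nX F n <= nX (fun z => F z - psum a n z).
Proof.
move=> HF; have sp := size_poly n (fun j => a j).
apply: le_trans (bestE_le (inX_series HF) sp) _.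
rewrite le_eqVlt; apply/orP; left; apply/eqP; congr nX; apply/funext => z.
rewrite (horner_coef_wide _ sp) /psum; congr (_ - _).
by apply: eq_bigr => j _; rewrite coef_poly ltn_ord.
Qed.

Variable mu : R.
Hypothesis mu_gt0 : 0 < mu.
Hypothesis Hmu : (fun n : nat => w n `^ (n%:R)^-1) @ \oo --> mu.

Lemma w_between lo hi : 0 < lo -> lo < mu -> mu < hi -> exists N : nat, forall n, (N <= n)%N ->
  lo ^+ n <= w n <= hi ^+ n.
Proof.
move=> lo0 lomu muhi.
have e0 : 0 < Num.min (mu - lo) (hi - mu) by rewrite lt_min !subr_gt0 lomu.
have /cvgrPdist_lt /(_ _ e0) [N _ HN] := Hmu.
exists N.+1 => n Nn; have n0 : (0 < n)%N by exact: leq_trans Nn.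
have := HN n (ltnW Nn); rewrite lt_min => /andP[h1 h2].
have wE : w n = (w n `^ (n%:R)^-1) ^+ n.
  rewrite -powR_mulrn ?powR_ge0// -powRrM mulVf ?pnatr_eq0 -?lt0n// powRr1//.
  exact/ltW/w_gt0.
set v := w n `^ _ in wE h1 h2; rewrite wE.
move: h1 h2; rewrite !ltr_norml => /andP[_ h1] /andP[h2 _].
apply/andP; split; apply: lerXn2r; rewrite ?nnegrE; lra.
Qed.

(** * Transfer of growth rates between coefficients and best approximation *)

Section GrowthRate.
Variable rho : R.
Hypothesis rho_gt0 : 0 < rho.

Definition best_rate (f : C -> C) (n : nat) : R :=
  n%:R / (expR 1 * rho) * (bestE nX f n / w n) `^ (rho / n%:R).

Lemma best_rate_lt_gmaj f A : inX f -> 0 < A ->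
  (limn_esup (fun n => (best_rate f n)%:E) < A%:E)%E ->
  gbounded rho (fun n => bestE nX f n / w n) A.
Proof.
move=> Xf A0 /limn_esup_lt[N HN]; exists N.+1 => n Nn.
rewrite -le_gmaj//; first by apply/ltW/HN; exact: ltnW.
- exact: leq_trans Nn.
- by rewrite divr_ge0 ?bestE_ge0// ltW ?w_gt0.
Qed.

(** The tail of [cabs (a j) * w j] from [n] on is at most [2 * gmaj A n * hi^n]. Dividing by
    [w n >= lo^n] costs [(hi / lo)^n], and the gain [q^n] between [gmaj A] and [gmaj B] outweighs
    it. *)
Lemma gbounded_best_rate F a A B : series_of F a -> 0 < A -> A < B ->
  gbounded rho (fun n => cabs (a n)) A ->
  (limn_esup (fun n => (best_rate F n)%:E) <= B%:E)%E.
Proof.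
move=> HF A0 AB [N0 H0]; have B0 : 0 < B by exact: lt_trans AB.
have [q [/andP[q0 q1] qE]] := gmaj_ratio rho_gt0 A0 AB.
(* Half of the value at which [q (mu + ep) = mu - ep]; hence [q * hi / lo < 1]. *)
pose ep := mu * (1 - q) / (2 * (1 + q)).
have q1' : 0 < 1 + q by rewrite addr_gt0.
have ep0 : 0 < ep by rewrite divr_gt0 ?mulr_gt0// subr_gt0.
have epE : ep * (1 + q) = mu * (1 - q) / 2 by rewrite /ep; field; rewrite gt_eqF.
have epmu : ep < mu.
  rewrite /ep ltr_pdivrMr ?mulr_gt0// ltr_pM2l//; lra.
pose hi := mu + ep; pose lo := mu - ep.
have lo0 : 0 < lo by rewrite subr_gt0.
have hi0 : 0 < hi by rewrite addr_gt0.
have k1 : 0 <= q * hi / lo < 1.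
  rewrite divr_ge0 ?mulr_ge0 ?ltW//= ltr_pdivrMr// mul1r /hi /lo.
  have : 0 < mu * (1 - q) by rewrite mulr_gt0// subr_gt0.
  lra.
have [N1 H1] := @w_between lo hi lo0 ltac:(rewrite /lo; lra) ltac:(rewrite /hi; lra).
(* Against weights [w j <= hi^j], a decay of ratio [1 / (2 hi)] leaves a series of ratio 1/2. *)
have s0 : 0 < 1 / (2 * hi) by rewrite divr_gt0// mulr_gt0.
have [N2 H2] := gmaj_decay rho_gt0 A0 s0.
have [N3 H3] := @geometric_lt R 2 _ 1 k1 ltr01.
apply: (@limn_esup_le _ _ _ (N0 + N1 + N2 + N3).+1) => n Nn.
have [nN0 nN1 nN2 nN3] : [/\ N0 <= n, N1 <= n, N2 <= n & N3 <= n]%N.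
  by move: Nn; clear; split; lia.
rewrite le_gmaj//; last 2 first.
- exact: leq_trans Nn.
- apply: divr_ge0; last exact/ltW/w_gt0.
  by apply: le_trans (coef_le_bestE n HF); apply: mulr_ge0; [exact: cabs_ge0|exact/ltW/w_gt0].
rewrite ler_pdivrMr ?w_gt0//.
apply: le_trans (bestE_le_remainder n HF) _.
apply: (@le_trans _ _ (2 * (gmaj rho A n * hi ^+ n))).
  apply: (remainder_le HF) => m nm.
  apply: (@le_trans _ _ (\sum_(n <= j < m) (gmaj rho A n * hi ^+ n * (1 / 2) ^- n) * (1 / 2) ^+ j)).
    rewrite big_nat_cond [leRHS]big_nat_cond; apply: ler_sum => j /andP[/andP[nj _] _].
    have a1 : cabs (a j) <= gmaj rho A n * (1 / (2 * hi)) ^+ (j - n).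
      exact: le_trans (H0 j (leq_trans nN0 nj)) (H2 n j nN2 nj).
    have /andP[_ w1] := H1 j (leq_trans nN1 nj).
    apply: le_trans (ler_pM (cabs_ge0 _) (ltW (w_gt0 j)) a1 w1) _.
    have -> : 1 / (2 * hi) = (1 / 2) * hi^-1 by field; rewrite gt_eqF.
    rewrite exprMn exprVn.
    have -> : hi ^+ j = hi ^+ (j - n) * hi ^+ n by rewrite -exprD subnK.
    have -> : (1 / 2) ^+ j = (1 / 2) ^+ (j - n) * (1 / 2) ^+ n :> R by rewrite -exprD subnK.
    have h1 : hi ^+ (j - n) != 0 by rewrite expf_neq0// gt_eqF.
    have h2 : (1 / 2) ^+ n != 0 :> R by rewrite expf_neq0//; lra.
    rewrite le_eqVlt; apply/orP; left; apply/eqP.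
    move: (gmaj rho A n) (hi ^+ (j - n)) (hi ^+ n) ((1 / 2) ^+ n) ((1 / 2) ^+ (j - n)) h1 h2 => x1 x2 x3 x4 x5 h1 h2.
    by field; rewrite h1 h2.
  rewrite -mulr_sumr.
  have gs := @geom_sum_le R (1 / 2) n m ltac:(lra).
  have h2 : 0 < (1 / 2) ^+ n :> R by rewrite exprn_gt0//; lra.
  have g0 : 0 <= gmaj rho A n * hi ^+ n * (1 / 2) ^- n.
    by rewrite !mulr_ge0 ?invr_ge0 ?exprn_ge0 ?ltW// gmaj_gt0.
  apply: le_trans (ler_wpM2l g0 gs) _.
  have -> : 1 - 1 / 2 = 2^-1 :> R by lra.
  rewrite invrK le_eqVlt; apply/orP; left; apply/eqP.
  by move: (gmaj rho A n) (hi ^+ n) ((1 / 2) ^+ n) h2 => x1 x2 x3 h2; field; rewrite gt_eqF.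
have /andP[w1 _] := H1 n nN1.
have h3 := H3 n nN3.
have lon : 0 < lo ^+ n by rewrite exprn_gt0.
apply: (@le_trans _ _ (gmaj rho B n * lo ^+ n)); last by rewrite ler_pM2l ?gmaj_gt0.
have -> : 2 * (gmaj rho A n * hi ^+ n) = (2 * (q * hi / lo) ^+ n) * (gmaj rho B n * lo ^+ n).
  rewrite qE expr_div_n exprMn.
  by move: (gmaj rho B n) (hi ^+ n) (lo ^+ n) (q ^+ n) lon => x1 x2 x3 x4 h; field; rewrite gt_eqF.
rewrite -[leRHS]mul1r ler_wpM2r//; last exact: ltW.
by apply: mulr_ge0; [exact/ltW/gmaj_gt0|exact: ltW].
Qed.

Lemma type_best_rate F sigma : entire F -> 0 < sigma ->
  type_of F rho = sigma%:E <-> limn_esup (fun n => (best_rate F n)%:E) = sigma%:E.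
Proof.
move=> /entire_series[a HF est] s0; split=> H; apply: ereal_eq_by_cuts => // A.
- move=> A0 HA; rewrite leNgt; apply/negP => As.
  have [h1 h2] : A < (A + sigma) / 2 /\ (A + sigma) / 2 < sigma by split; lra.
  have gb : gbounded rho (fun n => cabs (a n)) A.
    have [N HN] := best_rate_lt_gmaj (inX_series HF) A0 HA; exists N => n /HN.
    by apply: le_trans; rewrite ler_pdivlMr ?w_gt0//; exact: coef_le_bestE.
  have := gbounded_type_le rho_gt0 HF A0 h1 gb.
  by rewrite H lee_fin; lra.
- move=> sA; pose A1 := (sigma + A) / 2.
  have A10 : 0 < A1 by rewrite /A1; lra.
  apply: (@gbounded_best_rate F a A1) => //; first by rewrite /A1; lra.
  by apply: (type_lt_gbounded rho_gt0 HF est A10); rewrite H lte_fin /A1; lra.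
- move=> A0 HA; rewrite leNgt; apply/negP => As.
  have [h1 h2] : A < (A + sigma) / 2 /\ (A + sigma) / 2 < sigma by split; lra.
  have := gbounded_best_rate HF A0 h1 (type_lt_gbounded rho_gt0 HF est A0 HA).
  by rewrite H lee_fin; lra.
- move=> sA; pose A1 := (sigma + A) / 2.
  have A10 : 0 < A1 by rewrite /A1; lra.
  have H' : (limn_esup (fun n => (best_rate F n)%:E) < A1%:E)%E by rewrite H lte_fin /A1; lra.
  apply: (@gbounded_type_le _ _ rho_gt0 F a HF A1) => //; first by rewrite /A1; lra.
  have [N HN] := best_rate_lt_gmaj (inX_series HF) A10 H'; exists N => n /HN.
  by apply: le_trans; rewrite ler_pdivlMr ?w_gt0//; exact: coef_le_bestE.
Qed.

End GrowthRate.
End FunctionSpace.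

(** * Polynomials of best approximation *)

Section BestApproximants.
Variables (R : realType) (inX : set (R[i] -> R[i])) (nX : (R[i] -> R[i]) -> R).
Hypothesis HX : funBanach inX nX.
Local Notation C := (R[i]).
Local Notation w := (nXmono nX).
Variable mu : R.
Hypothesis mu_gt0 : 0 < mu.
Hypothesis Hmu : (fun n : nat => w n `^ (n%:R)^-1) @ \oo --> mu.

Lemma bestE_ext f g n : inX f -> (forall z, disk z -> f z = g z) ->
  bestE nX f n = bestE nX g n.
Proof.
move=> Xf fg; have H (p : {poly C}) : (size p <= n)%N ->
    nX (fun z => f z - p.[z]) = nX (fun z => g z - p.[z]).
  move=> sp; apply: (nX_ext HX) => [|z /fg -> //].
  by apply: (X_sub HX) => //; rewrite (poly_psum sp); exact: (inX_psum HX).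
congr inf; apply/seteqP; split=> _ [p sp <-]; exists p => //.
  by rewrite H.
by rewrite H.
Qed.

Lemma series_horner (p : {poly C}) : series_of (horner p) (fun j => p`_j).
Proof.
rewrite (poly_psum (leqnn _)); have := series_psum (fun j => p`_j) (size p).
congr series_of; apply/funext => j; case: ltnP => // pj.
by rewrite nth_default.
Qed.

(** At radius 4, one factor [2^n] absorbs [n] and the other one remains as decay. *)
Lemma rapid_to_geometric (u : nat -> R) : (forall n, 0 <= u n) -> rapid u ->
  exists2 K, 0 <= K & forall n, n%:R * u n <= K * (1 / 2) ^+ n.
Proof.
move=> u0 ru; have [K K0 HK] := rapid_bound ru (ltr0Sn R 3); exists K => // n.
have h2 : 0 < (2 : R) ^+ n by rewrite exprn_gt0.
rewrite expr_div_n expr1n mulrA mulr1 ler_pdivlMr//.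
apply: le_trans (HK n); have -> : (4 : R) ^+ n = 2 ^+ n * 2 ^+ n.
  by rewrite -exprMn; congr (_ ^+ _); ring.
rewrite mulrAC mulrC ler_wpM2l// ler_wpM2r ?ltW//.
by rewrite -natrX ltr_nat ltn_expl.
Qed.

Section Converse.
Variables (f : C -> C) (p : nat -> {poly C}).
Hypothesis Xf : inX f.
Hypothesis Hp : forall n, (size (p n) <= n)%N /\ nX (fun z => f z - (p n).[z]) = bestE nX f n.
Local Notation E := (bestE nX f).
Hypothesis rapidE : rapid (fun n => E n / w n).

Let Xp n : inX (horner (p n)).
Proof. exact: (inX_series HX (series_horner (p n))). Qed.
Let E0 n : 0 <= E n. Proof. exact: (bestE_ge0 HX). Qed.
Let w0 n : 0 < w n. Proof. exact: (w_gt0 HX). Qed.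

Let E_antitone n m : (n <= m)%N -> E m <= E n.
Proof.
move=> nm; have [s <-] := Hp n; apply: (bestE_le HX) => //; exact: leq_trans nm.
Qed.

Let coef_cauchy k n m : (n <= m)%N -> cabs ((p m)`_k - (p n)`_k) <= 2 * E n / w k.
Proof.
move=> nm; rewrite ler_pdivlMr//.
apply: le_trans (coef_norm_le HX k (seriesB (series_horner (p m)) (series_horner (p n)))) _.
apply: le_trans (nX_trans HX (Xp m) Xf (Xp n)) _.
rewrite (nX_subC HX (Xp m) Xf) (Hp m).2 (Hp n).2 mulr_natl mulr2n.
by rewrite lerD2r E_antitone.
Qed.

(** The 4 is the 2 of [coef_cauchy], doubled because real and imaginary parts converge
    separately. *)
Let limcoef : {a : nat -> C | forall k n, cabs (a k - (p n)`_k) <= 4 * E n / w k}.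
Proof.
apply: cid; have H k : exists l, forall n, cabs (l - (p n)`_k) <= 4 * E n / w k.
  have [l Hl] := cauchy_complex (fun n m => @coef_cauchy k n m).
  exists l => n; apply: le_trans (Hl n) _.
  by rewrite le_eqVlt; apply/orP; left; apply/eqP; ring.
by exists (fun k => projT1 (cid (H k))) => k; exact: (projT2 (cid (H k))).
Qed.

Let a := projT1 limcoef.
Let aP k n : cabs (a k - (p n)`_k) <= 4 * E n / w k. Proof. exact: (projT2 limcoef). Qed.

Let rapid_a : rapid (fun n => cabs (a n)).
Proof.
move=> r r0; have [K HK] := rapidE r0; exists (4 * K) => n.
(* [p n] has no coefficient of index [n], so this is a bound on [a n] alone. *)
have := aP n n; rewrite nth_default ?(Hp n).1// subr0 -mulrA => h.
apply: (@le_trans _ _ (4 * (E n / w n) * r ^+ n)).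
  by apply: ler_wpM2r h; rewrite exprn_ge0// ltW.
by rewrite -mulrA ler_wpM2l.
Qed.

Let rapid_bestE : rapid E.
Proof.
have m0 := mu_gt0.
have mu2 : mu < 2 * mu by lra.
have mu1 : mu / 2 < mu by lra.
have mu0 : 0 < mu / 2 by lra.
have [N HN] := w_between HX Hmu mu0 mu1 mu2.
move=> r r0; have [K K0 HK] := rapid_bound rapidE (mulr_gt0 (mulr_gt0 (ltr0Sn R 1) mu_gt0) r0).
have [M [M0 HM]] := finite_max (fun n => E n * r ^+ n) N.
exists (M + K) => n; have [/HM h|Nn] := ltnP n N; first by apply: le_trans h _; rewrite lerDl.
apply: le_trans (_ : K <= _); last by rewrite lerDr.
apply: le_trans (HK n); rewrite exprMn mulrA ler_pM2r ?exprn_gt0//.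
rewrite mulrAC ler_pdivlMr// ler_wpM2l//.
by have /andP[] := HN n Nn.
Qed.

Let nE_lt e : 0 < e -> exists N : nat, forall n, (N <= n)%N -> n%:R * E n < e.
Proof.
move=> e0; have [K K0 HK] := rapid_to_geometric E0 rapid_bestE.
have [N HN] := @geometric_lt R K (1 / 2) e ltac:(lra) e0.
by exists N => n /HN; apply: le_lt_trans.
Qed.

(** Used twice: [v = w] gives distances in [X], and [v j = r^j] gives uniform distances on the disk
    of radius [r]. *)
Let coef_sum_le (v : nat -> R) M n : 0 <= M -> (forall j, 0 <= v j <= M * w j) ->
  \sum_(j < n) cabs (a j - (p n)`_j) * v j <= 4 * M * (n%:R * E n).
Proof.
move=> M0 Hv; apply: (@le_trans _ _ (\sum_(j < n) (4 * M * E n))).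
  apply: ler_sum => j _; have /andP[v0 vM] := Hv j.
  apply: le_trans (ler_pM (cabs_ge0 _) v0 (aP j n) vM) _.
  by rewrite le_eqVlt; apply/orP; left; apply/eqP; field; rewrite gt_eqF.
rewrite sumr_const card_ord -mulr_natr.
by rewrite le_eqVlt; apply/orP; left; apply/eqP; ring.
Qed.

Let psumB_coef n z : psum a n z - (p n).[z] = psum (fun j => a j - (p n)`_j) n z.
Proof.
rewrite (horner_coef_wide z (Hp n).1) /psum -sumrB.
by apply: eq_bigr => j _; rewrite mulrBl.
Qed.

Lemma best_approx_limit : exists F : C -> C, [/\ entire F, forall z, disk z -> f z = F z
  & forall r : R, 0 < r < mu -> forall e : R, 0 < e -> exists N : nat, forall n : nat, (N <= n)%N ->
      forall z : C, cabs z < r -> cabs ((p n).[z] - F z) < e].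
Proof.
have [F HF] := series_exists rapid_a; exists F.
have XF := inX_series HX HF; split; first exact: series_entire HF.
- suff /(nX_eq0 HX (X_sub HX Xf XF)) H : nX (fun z => f z - F z) = 0.
    by move=> z /H /eqP; rewrite subr_eq0 => /eqP.
  apply/eqP; rewrite eq_le (nX_ge0 HX (X_sub HX Xf XF)) andbT.
  apply/ler_addgt0Pr => e e0; rewrite add0r.
  (* The distance from [f] to [F] through [p n] and [psum a n] costs at most [E n + 4 n E n] plus
     the remainder, that is, 6 of these eighths. *)
  have e8 : 0 < e / 8 by lra.
  have [N1 H1] := nE_lt e8; have [N2 H2] := remainder_cvg HX HF e8.
  pose n := (N1 + N2).+1.
  have {}H1 : n%:R * E n < e / 8 by apply: H1; rewrite /n -addnS leq_addr.
  have {}H2 : nX (fun z => F z - psum a n z) < e / 8 by apply: H2; rewrite /n -addSn leq_addl.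
  have h1 : E n <= n%:R * E n by rewrite ler_peMl// ler1n.
  have h2 : nX (fun z => psum a n z - (p n).[z]) <= 4 * 1 * (n%:R * E n).
    have -> : (fun z => psum a n z - (p n).[z]) = (fun z => psum (fun j => a j - (p n)`_j) n z
        - psum (fun j => a j - (p n)`_j) 0 z).
      by apply/funext => z; rewrite psumB_coef /psum big_ord0 subr0.
    apply: le_trans (nX_psum_diff HX _ (leq0n n)) _; rewrite big_mkord.
    by apply: coef_sum_le => // j; rewrite mul1r lexx ltW.
  have := nX_trans HX Xf (Xp n) XF; rewrite (Hp n).2.
  have := nX_trans HX (Xp n) (inX_psum HX a n) XF.
  rewrite (nX_subC HX (Xp n) (inX_psum HX a n)) (nX_subC HX (inX_psum HX a n) XF).
  lra.
- move=> r /andP[r0 rmu] e e0.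
  have mu2 : mu < 2 * mu by lra.
  (* Here [r < mu] enters: it serves as the lower rate of [w], so [r^j <= w j] from some index
     on. *)
  have [N HN] := w_between HX Hmu r0 rmu mu2.
  have [M [M0 HM]] := finite_max (fun j => r ^+ j / w j) N.
  have rw j : 0 <= r ^+ j <= (M + 1) * w j.
    apply/andP; split; first by rewrite exprn_ge0// ltW.
    rewrite -ler_pdivrMr//.
    have [/HM h|Nj] := ltnP j N; first by apply: le_trans h _; rewrite lerDl.
    apply: (@le_trans _ _ 1); last by rewrite lerDr.
    by rewrite ler_pdivrMr// mul1r; have /andP[] := HN j Nj.
  have M1 : 0 < M + 1 by rewrite ltr_wpDl.
  have r2 : 0 < 2 * r by rewrite mulr_gt0.
  (* Radius [2 r] makes the ratio of the tail at most 1/2 throughout the disk, uniformly in [z]. *)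
  have [K K0 HK] := rapid_bound rapid_a r2.
  have e1 : 0 < e / 2 / (4 * (M + 1)) by rewrite !divr_gt0// mulr_gt0.
  have e2 : 0 < e / 2 by lra.
  have [N1 H1] := nE_lt e1.
  have [N2 H2] := @geometric_lt R (K * 2) (1 / 2) (e / 2) ltac:(lra) e2.
  exists (N1 + N2)%N => n Nn z zr.
  have {}H1 := H1 n (leq_trans (leq_addr _ _) Nn).
  have {}H2 := H2 n (leq_trans (leq_addl _ _) Nn).
  have z2 : cabs z < 2 * r by lra.
  have t1 : cabs (F z - psum a n z) < e / 2.
    apply: le_lt_trans H2; apply: le_trans (series_tail n HF z2 K0 HK) _.
    have q2 : cabs z / (2 * r) <= 1 / 2.
      by rewrite ler_pdivrMr//; lra.
    have q0 : 0 <= cabs z / (2 * r) by rewrite divr_ge0 ?cabs_ge0 ?ltW.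
    apply: ler_pM.
    + by rewrite divr_ge0// subr_ge0; lra.
    + exact: exprn_ge0.
    + rewrite ler_wpM2l// -[leRHS]invrK lef_pV2 ?posrE; lra.
    + by rewrite lerXn2r ?nnegrE//; lra.
  have t2 : cabs (psum a n z - (p n).[z]) < e / 2.
    rewrite psumB_coef; apply: (@le_lt_trans _ _ (4 * (M + 1) * (n%:R * E n))); last first.
      by move: H1; rewrite ltr_pdivlMr ?mulr_gt0// mulrC.
    apply: le_trans (coef_sum_le n (ltW M1) rw).
    apply: le_trans (cabs_sum _ _ _) _; apply: ler_sum => j _.
    rewrite cabsM cabsX ler_wpM2l ?cabs_ge0//.
    by rewrite lerXn2r ?nnegrE ?cabs_ge0 ?ltW.
  rewrite cabsBC -(subrKA (psum a n z)); apply: le_lt_trans (cabsD _ _) _; lra.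
Qed.

End Converse.
End BestApproximants.

Theorem theorem4p3 (R : realType) (inX : set (R[i] -> R[i]))
  (nX : (R[i] -> R[i]) -> R) (HX : funBanach inX nX)
  (mu : R) (mu_gt0 : 0 < mu)
  (Hmu : (fun n : nat => nXmono nX n `^ (n%:R)^-1) @ \oo --> mu)
  (f : R[i] -> R[i]) (Hf : inX f) (rho sigma : R)
  (rho_gt0 : 0 < rho) (sigma_gt0 : 0 < sigma) :
  ((exists F : R[i] -> R[i], entire F /\ order_of F = rho%:E /\
       type_of F rho = sigma%:E /\ (forall z, disk z -> f z = F z)) ->
    limn_esup (fun n : nat => (n%:R / (expR 1 * rho) *
        (bestE nX f n / nXmono nX n) `^ (rho / n%:R))%:E) = sigma%:E)
  /\
  (limn_esup (fun n : nat => (n%:R / (expR 1 * rho) *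
        (bestE nX f n / nXmono nX n) `^ (rho / n%:R))%:E) = sigma%:E ->
    forall p : nat -> {poly R[i]},
      (forall n, (size (p n) <= n)%N /\
                 nX (fun z => f z - (p n).[z]) = bestE nX f n) ->
      exists F : R[i] -> R[i], entire F /\ order_of F = rho%:E /\
        type_of F rho = sigma%:E /\
        (forall r : R, 0 < r < mu -> forall e : R, 0 < e ->
           exists N : nat, forall n : nat, (N <= n)%N ->
             forall z : R[i], cabs z < r -> cabs ((p n).[z] - F z) < e)).
Proof.
have rateE F : (forall z, disk z -> f z = F z) -> best_rate nX rho f = best_rate nX rho F.
  by move=> fF; apply/funext => n; rewrite /best_rate (bestE_ext HX n Hf fF).
split=> [[F [eF [_ [tF fF]]]]|H p Hp].
  have := (type_best_rate HX mu_gt0 Hmu rho_gt0 eF sigma_gt0).1 tF.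
  by rewrite -(rateE F fF).
(* Any finite constant above [sigma] yields the rapid decay from which [F] is built; the exact value
   [sigma] is used only afterwards, for the type of [F]. *)
have s1 : 0 < sigma + 1 by rewrite addr_gt0.
have gb : gbounded rho (fun n => bestE nX f n / nXmono nX n) (sigma + 1).
  apply: (best_rate_lt_gmaj HX rho_gt0 Hf s1).
  by rewrite (_ : limn_esup _ = sigma%:E)// lte_fin ltrDl.
have rE : rapid (fun n => bestE nX f n / nXmono nX n).
  apply: (gbounded_rapid rho_gt0 s1 _ gb) => n.
  by apply: divr_ge0; [exact: (bestE_ge0 HX)|exact/ltW/(w_gt0 HX)].
have [F [eF fF uF]] := best_approx_limit HX mu_gt0 Hmu Hf Hp rE.
have tF : type_of F rho = sigma%:E.
  apply/(type_best_rate HX mu_gt0 Hmu rho_gt0 eF sigma_gt0).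
  by rewrite -(rateE F fF).
exists F; split=> //; split=> //.
exact: type_order tF.
Qed.
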